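(* If a semigroup $X$ is $\mathsf{T_{\!z}S}$-closed, then its ideal center $I\!Z(X)$ is $\mathsf{T_{\!1}S}$-closed.
   Context: A topological semigroup is a topological space with a continuous associative operation. $\mathsf{T_{\!1}S}$ is the class of $T_1$ topological semigroups and $\mathsf{T_{\!z}S}$ the class of Tychonoff zero-dimensional topological semigroups. For a class $\mathcal C$ of topological semigroups, a semigroup $S$ is $\mathcal C$-closed if, endowed with the discrete topology, for every isomorphic topological embedding $h:S\to Y$ into a topological semigroup $Y\in\mathcal C$ the image $h[S]$ is closed in $Y$. $Z(X)=\{z\in X:\forall x\in X\ (xz=zx)\}$ and $I\!Z(X)=\{z\in Z(X):zX\subseteq Z(X)\}$. *)

(* Defs.v *)
From mathcomp Require Import all_boot all_classical all_reals all_analysis.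
Set Implicit Arguments. Unset Strict Implicit. Unset Printing Implicit Defensive.
Local Open Scope classical_set_scope.

Definition top_semigroup (Y : topologicalType) (m : Y -> Y -> Y) : Prop :=
  associative m /\ continuous (fun p : Y * Y => m p.1 p.2).

Definition zero_dim (Y : topologicalType) : Prop :=
  forall (U : set Y) (x : Y), open U -> U x ->
    exists V : set Y, [/\ clopen V, V x & V `<=` U].

Definition tychonoff (Y : topologicalType) : Prop :=
  accessible_space Y /\ completely_regular_space Y.

Definition T1S (Y : topologicalType) (m : Y -> Y -> Y) : Prop :=
  top_semigroup m /\ accessible_space Y.

Definition TzS (Y : topologicalType) (m : Y -> Y -> Y) : Prop :=
  top_semigroup m /\ tychonoff Y /\ zero_dim Y.

(* h : S -> Y is a topological embedding when S carries the discrete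
   topology: injective, (automatically continuous), and a homeomorphism
   onto its image, i.e. the image of every (open = arbitrary) subset of S
   is relatively open in h[S]. *)
Definition discrete_top_embedding (S : Type) (Y : topologicalType) (h : S -> Y)
  : Prop :=
  injective h /\
  forall U : set S, exists V : set Y, open V /\ h @` U = V `&` range h.

Definition C_closed
  (C : forall Y : topologicalType, (Y -> Y -> Y) -> Prop)
  (S : Type) (op : S -> S -> S) : Prop :=
  forall (Y : topologicalType) (m : Y -> Y -> Y), C Y m ->
  forall h : S -> Y,
    (forall a b, h (op a b) = m (h a) (h b)) ->
    discrete_top_embedding h ->
    closed (range h).

Definition center (X : Type) (op : X -> X -> X) : set X :=
  [set z | forall x, op x z = op z x].

Definition ideal_center (X : Type) (op : X -> X -> X) : set X :=
  [set z | center op z /\ forall x, center op (op z x)].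

Definition IZtype (X : Type) (op : X -> X -> X) := {z : X | ideal_center op z}.

Lemma ideal_center_mul (X : Type) (op : X -> X -> X) (Hassoc : associative op)
  (a b : X) : ideal_center op a -> ideal_center op b -> ideal_center op (op a b).
Proof.
move=> [_ Ha] [_ Hb]; split; first exact: Ha.
by move=> x; rewrite -Hassoc; apply: Ha.
Qed.

Definition IZop (X : Type) (op : X -> X -> X) (Hassoc : associative op)
  (a b : IZtype op) : IZtype op :=
  exist _ (op (proj1_sig a) (proj1_sig b))
    (ideal_center_mul Hassoc (proj2_sig a) (proj2_sig b)).

(* Main.v *)
(* A filter on a semigroup is the germ of a potential new point, and the filters
   of a product-closed family, topologized by their members, form a topological
   semigroup (lemma [TzS_closed_filters]).  Hence in a TzS-closed semigroup X no
   suitable product-closed family contains a free filter.  Applied to central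
   filters built from, respectively, an infinite set with one-point square, an
   infinite set of x, y with xy in {x, y}, the powers z^(n!), and a lacunary
   sequence in an unbounded subgroup, this shows that IZ(X) is nonsingular,
   chain-finite, periodic and group-bounded.  Only the last step uses that IZ(X)
   is an ideal: it turns translations by X into translations by elements of IZ(X).

   Conversely let S be commutative with these four properties, embedded
   discretely in a T1 topological semigroup.  The filters on S that converge are
   closed under products, and such a filter contains {s} as soon as s lies in all
   its members.  A free convergent filter is first multiplied by a minimal
   idempotent, then squared, so as to live on the set of z with pi(z) = e and
   ez = t fixed (pi(z) the idempotent power of z).  Then x V is principal for
   every such x, and suitable values x b^m, with m about half of the least k such
   that x b^k is in eS, form an infinite set with square {e}, a contradiction. *)
Require Import Defs.
From mathcomp Require Import all_boot all_classical all_reals all_analysis.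
From HB Require Import structures.
From mathcomp Require Import zify.
(* Restores [Defs.center], which the MathComp imports shadow. *)
Import Defs.
Set Implicit Arguments. Unset Strict Implicit. Unset Printing Implicit Defensive.
Local Open Scope classical_set_scope.

(** * Topological semigroups of filters *)

(** The indicator of [U] pulls the discrete uniformity of [bool] back to [T]; the entourage of equal
    values separates [U] from its complement. *)
Lemma clopen_uniform_separator (T : topologicalType) (U : set T) :
  clopen U -> uniform_separator U (~` U).
Proof.
move=> [oU cU]; pose f x : bool := `[< U x >].
have Uf x : U x -> f x = true by move=> /asboolT.
have nUf x : ~ U x -> f x = false by move=> /asboolF.
pose T' : uniformType := initial_topology f.
exists (Uniform.class T'), [set xy | f xy.1 = f xy.2]; split.
- exists [set xy | xy.1 = xy.2] => //.
  by rewrite uniform_discrete => _ [b _ <-].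
- by rewrite -subset0 => -[a b [[/= /Uf -> /nUf ->]]].
- move=> x W [V [[V' oV <- /=] Vx]] /filterS; apply.
  have [Ux|nUx] := pselect (U x).
    apply: (@filterS _ _ _ U); first by move=> y /Uf; rewrite /= -(Uf x Ux) => ->.
    exact: open_nbhs_nbhs.
  apply: (@filterS _ _ _ (~` U)).
    by move=> y /nUf; rewrite /= -(nUf x nUx) => ->.
  by apply: open_nbhs_nbhs; split => //; exact: closed_openC.
Qed.

Lemma zero_dim_completely_regular (T : topologicalType) :
  zero_dim T -> completely_regular_space T.
Proof.
move=> zT a B cB nBa; have [V [clV Va VB]] := zT _ _ (closed_openC cB) nBa.
have [uT [E [entE VE coarse]]] := clopen_uniform_separator clV.
exists uT, E; split => //; rewrite -subset0 => -[x y [[/= -> By] Exy]].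
by rewrite -subset0 in VE; apply: (VE (a, y)); split => //; split => // /VB.
Qed.

Section FilterMul.
Variables (X : Type) (op : X -> X -> X).
Hypothesis opA : associative op.

(** [A] and [B] are chosen independently, unlike in the Stone-Cech product of ultrafilters. This
    makes the product jointly continuous, but [fmul U U] need not be an ultrafilter. *)
Definition fmul (F G : set_system X) : set_system X :=
  [set C | exists A B, [/\ F A, G B & forall a b, A a -> B b -> C (op a b)]].

Definition fpure (x : X) : set_system X := [set A | A x].

Lemma fpure_proper x : ProperFilter (fpure x).
Proof.
apply: Build_ProperFilter_ex => [A Ax|]; first by exists x.
by split=> // A B AB Ax; apply: AB.
Qed.

Lemma fmul_proper F G : ProperFilter F -> ProperFilter G -> ProperFilter (fmul F G).
Proof.
move=> PF PG; apply: Build_ProperFilter_ex.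
  move=> C [A [B [FA GB AB]]].
  have [a Aa] := filter_ex FA; have [b Bb] := filter_ex GB.
  by exists (op a b); apply: AB.
split.
- by exists setT, setT; split => //; exact: filterT.
- move=> P Q [A [B [FA GB AB]]] [A' [B' [FA' GB' AB']]].
  exists (A `&` A'), (B `&` B'); split; [exact: filterI|exact: filterI|].
  by move=> a b [? ?] [? ?]; split; [exact: AB|exact: AB'].
- move=> P Q PQ [A [B [FA GB AB]]]; exists A, B; split => // a b Aa Bb.
  by apply: PQ; apply: AB.
Qed.

Lemma fmulA F G H : fmul F (fmul G H) = fmul (fmul F G) H.
Proof.
apply/seteqP; split=> C.
  move=> [A [B [FA [A' [B' [GA' HB' AB']]] AB]]].
  exists [set x | exists a b, [/\ A a, A' b & x = op a b]], B'; split => //.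
    by exists A, A'; split => // a b Aa Bb; exists a, b.
  move=> _ c [a [b [Aa A'b ->]]] B'c; rewrite -opA.
  by apply: AB => //; apply: AB'.
move=> [A [B [[A' [B' [GA' HB' AB']]] FA AB]]].
exists A', [set x | exists a b, [/\ B' a, B b & x = op a b]]; split => //.
  by exists B', B; split => // a b Aa Bb; exists a, b.
move=> a _ A'a [b [c [Aa A'b ->]]]; rewrite opA.
by apply: AB => //; apply: AB'.
Qed.

Lemma fmul_pure x y : fmul (fpure x) (fpure y) = fpure (op x y).
Proof.
apply/seteqP; split=> C.
  by move=> [A [B [Ax By AB]]]; apply: AB.
by move=> Cxy; exists [set x], [set y]; split => // _ _ -> ->.
Qed.

(** For such [B] the basic set [fnbh B] is clopen: its complement is the basic set of the complement
    of [B]. *)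
Definition decided (Y : set (set_system X)) (B : set X) :=
  forall G, Y G -> G B \/ G (~` B).

End FilterMul.
Arguments fpure {X} x.

Definition filter_space (X : Type) (Y : set (set_system X)) :=
  {F : set_system X | ProperFilter F /\ Y F}.
HB.instance Definition _ X Y := gen_eqMixin (@filter_space X Y).
HB.instance Definition _ X Y := gen_choiceMixin (@filter_space X Y).

Section FilterSpace.
Variables (X : Type) (Y : set (set_system X)).

Definition fnbh (A : set X) : set (filter_space Y) := [set F | sval F A].

Lemma fnbh_cover : \bigcup_(A in [set: set X]) fnbh A = setT.
Proof.
apply/seteqP; split => // -[F [PF YF]] _; exists setT => //.
by rewrite /fnbh /=; exact: filterT.
Qed.

Lemma fnbh_join (A B : set X) (F : filter_space Y) :
  [set: set X] A -> [set: set X] B -> fnbh A F -> fnbh B F ->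
  exists C, [/\ [set: set X] C, fnbh C F & fnbh C `<=` fnbh A `&` fnbh B].
Proof.
case: F => F [PF YF] _ _; rewrite /fnbh /= => FA FB.
exists (A `&` B); split => //=; first exact: filterI.
by move=> [G [PG YG]] /= GAB; split; apply: filterS GAB => x [].
Qed.

HB.instance Definition _ :=
  isBaseTopological.Build (filter_space Y) fnbh_cover fnbh_join.

Lemma fnbh_open A : open (fnbh A).
Proof. by exists [set A] => //; rewrite bigcup_set1. Qed.

Lemma openP_fnbh (U : set (filter_space Y)) (F : filter_space Y) : open U -> U F ->
  exists2 A, sval F A & fnbh A `<=` U.
Proof.
move=> [D _ <-] [A DA FA]; exists A => // G GA; by exists A.
Qed.

Lemma nbhsP_fnbh (U : set (filter_space Y)) (F : filter_space Y) : nbhs F U <->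
  exists2 A, sval F A & fnbh A `<=` U.
Proof.
split=> [|[A FA AU]].
  rewrite nbhsE => -[V [oV VF] VU]; have [A FA AV] := openP_fnbh oV VF.
  by exists A => //; exact: subset_trans VU.
by apply: filterS AU _; apply: open_nbhs_nbhs; split => //; exact: fnbh_open.
Qed.

Hypothesis Ydecided : forall F A, Y F -> F A ->
  exists B, [/\ F B, B `<=` A & decided Y B].

Lemma fnbh_clopen B : decided Y B -> clopen (fnbh B).
Proof.
move=> dB; split; first exact: fnbh_open.
have -> : fnbh B = ~` fnbh (~` B); last exact/open_closedC/fnbh_open.
apply/seteqP; split=> -[F [PF YF]]; rewrite /fnbh /= => FB.
  by move=> FB'; have [x []] := filter_ex (filterI FB FB').
by have [] := dB F YF.
Qed.

Lemma filter_space_zero_dim : zero_dim (filter_space Y).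
Proof.
move=> U F oU UF; have [A FA AU] := openP_fnbh oU UF.
have [B [FB BA dB]] := Ydecided (proj2 (svalP F)) FA.
exists (fnbh B); split => //; first exact: fnbh_clopen.
apply: subset_trans AU => -[G [PG YG]]; rewrite /fnbh /= => GB.
exact: filterS GB.
Qed.

(** Inclusion of [F] in [G] forces equality: a decided member of [G] missing from [F] would have its
    complement in [F], hence in [G]. *)
Lemma filter_space_accessible : accessible_space (filter_space Y).
Proof.
move=> [F [PF YF]] [G [PG YG]] /eqP FG.
suff [B FB GB] : exists2 B, F B & ~ G B.
  exists (fnbh B); split; [exact: fnbh_open|exact/mem_set|].
  by apply/mem_set.
apply: contrapT => FG0; apply: FG; apply: eq_exist => /=.
have sFG A : F A -> G A by move=> FA; apply: contrapT => GA; apply: FG0; exists A.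
apply/seteqP; split=> // A GA.
have [B [GB BA dB]] := Ydecided YG GA.
have [FB|/sFG GB'] := dB F YF; first exact: filterS FB.
by have [x []] := filter_ex (filterI GB GB').
Qed.

End FilterSpace.

(* Topologized by the sets of filters having a given member, a family of filters
   closed under the product is a topological semigroup in which the principal
   filters are a discrete dense copy of [X]. *)
Lemma TzS_closed_filters (X : Type) (op : X -> X -> X) (Y : set (set_system X)) :
    associative op -> C_closed TzS op ->
    (forall F, Y F -> ProperFilter F) -> (forall x, Y (fpure x)) ->
    (forall F G, Y F -> Y G -> Y (fmul op F G)) ->
    (forall F A, Y F -> F A -> exists B, [/\ F B, B `<=` A & decided Y B]) ->
  forall F, Y F -> exists x, F [set x].
Proof.
move=> opA clX Yproper Ypure Ymul Ydec F YF.
have Ymul' (P Q : filter_space Y) :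
    ProperFilter (fmul op (sval P) (sval Q)) /\ Y (fmul op (sval P) (sval Q)).
  case: P Q => [P [PP YP]] [Q [PQ YQ]] /=.
  by split; [exact: fmul_proper|exact: Ymul].
pose m P Q : filter_space Y := exist _ _ (Ymul' P Q).
pose h x : filter_space Y := exist _ (fpure x) (conj (fpure_proper x) (Ypure x)).
have TzSm : TzS m.
  have zd := filter_space_zero_dim Ydec; split; last first.
    split => //; split; last exact: zero_dim_completely_regular.
    exact: filter_space_accessible.
  split; first by move=> P Q R; apply: eq_exist; exact: fmulA.
  move=> [P Q] U /nbhsP_fnbh[C PQC CU]; have [A [B [PA QB AB]]] := PQC.
  exists (fnbh A, fnbh B) => /=.
    by split; apply/nbhsP_fnbh; [exists A|exists B].
  by move=> [P' Q'] [/= P'A Q'B]; apply: CU; exists A, B.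
have hM a b : h (op a b) = m (h a) (h b).
  by apply: eq_exist; rewrite /= fmul_pure.
have hE : discrete_top_embedding h.
  split.
    move=> a b /(congr1 sval)/= ab; have : fpure b [set a] by rewrite -ab.
    by move=> ->.
  move=> U; exists (fnbh U); split; first exact: fnbh_open.
  apply/seteqP; split=> [G [x Ux <-]|G [UG [x _ xG]]].
    by split => //; exists x.
  by exists x => //; move: UG; rewrite -xG.
pose F' : filter_space Y := exist _ F (conj (Yproper F YF) YF).
have : range h F'.
  apply: (clX _ _ TzSm h hM hE) => U /nbhsP_fnbh[A FA AU].
  have PF := Yproper _ YF; have [a Aa] := filter_ex FA.
  by exists (h a); split; [exists a|exact: AU].
by case=> x _ /(congr1 sval)/= xF; exists x; rewrite -xF.
Qed.

(** * Families of central filters *)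

Section CentralFilters.
Variables (X : Type) (op : X -> X -> X).
Hypothesis opA : associative op.

Lemma fmul_pureP x F A : Filter F ->
  fmul op (fpure x) F A <-> F [set y | A (op x y)].
Proof.
move=> FF; split=> [[P [Q [Px FQ PQ]]]|FA].
  by apply: filterS FQ => y Qy; apply: PQ.
by exists [set x], [set y | A (op x y)]; split => // _ b -> .
Qed.

Lemma fmul_pureC x F : Filter F -> F (center op) ->
  fmul op (fpure x) F = fmul op F (fpure x).
Proof.
move=> FF Fc; apply/seteqP; split=> A [P [Q [FP FQ PQ]]].
  exists (center op `&` Q), P; split => //; first exact: filterI.
  by move=> a b [ac Qa] Pb; rewrite -ac; apply: PQ.
exists Q, (center op `&` P); split => //; first exact: filterI.
by move=> a b Qa [bc Pb]; rewrite bc; apply: PQ.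
Qed.

(** [None] acts as an adjoined unit, so that a filter and its translates are treated together. *)
Definition shift (o : option X) (y : X) := if o is Some x then op x y else y.

Definition fshift (o : option X) (F : set_system X) :=
  if o is Some x then fmul op (fpure x) F else F.

Lemma fshiftP o F A : Filter F -> fshift o F A <-> F [set y | A (shift o y)].
Proof. by case: o => [x|//] FF; exact: fmul_pureP. Qed.

Lemma fshift_proper o F : ProperFilter F -> ProperFilter (fshift o F).
Proof. by case: o => [x|//] PF; apply: fmul_proper => //; exact: fpure_proper. Qed.

(** The family [Y] consists of the principal filters and the translates of members of [Gam].
    Centrality moves the translating elements to the front, which makes [Y] closed under
    products. *)
Lemma TzS_closed_central_filters (Gam : set (set_system X)) :
    C_closed TzS op ->
    (forall F, Gam F -> ProperFilter F) -> (forall F, Gam F -> F (center op)) ->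
    (forall F G, Gam F -> Gam G ->
       Gam (fmul op F G) \/ exists c, fmul op F G = fpure c) ->
    (forall o G x, Gam G -> fshift o G [set x] \/ fshift o G (~` [set x])) ->
    (forall o G A, Gam G -> fshift o G A -> exists B,
       [/\ fshift o G B, B `<=` A & forall o' G', Gam G' ->
           fshift o' G' B \/ fshift o' G' (~` B)]) ->
  forall F, Gam F -> exists x, F [set x].
Proof.
move=> clX Gproper Gcenter Gmul Gpoint Gbase F GF.
pose Y : set (set_system X) := [set F | (exists x, F = fpure x) \/
  exists o G, Gam G /\ F = fshift o G].
have YG o G : Gam G -> Y (fshift o G) by move=> GG; right; exists o, G.
have dpure (x : X) (B : set X) : fpure x B \/ fpure x (~` B).
  by have [Bx|Bx] := pselect (B x); [left|right].
have commG x G : Gam G -> fmul op G (fpure x) = fmul op (fpure x) G.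
  move=> GG; have PG := Gproper _ GG.
  by rewrite fmul_pureC //; exact: Gcenter.
have Ymul P Q : Y P -> Y Q -> Y (fmul op P Q).
  have Ypure x P' : Y P' -> Y (fmul op (fpure x) P').
    case=> [[y ->]|[[y|] [G [GG ->]]]] /=.
    - by rewrite fmul_pure; left; exists (op x y).
    - by rewrite fmulA // fmul_pure; exact: (YG (Some _)).
    - exact: (YG (Some x)).
  have YGG G H : Gam G -> Gam H -> Y (fmul op G H).
    move=> GG GH; have [GGH|[c ->]] := Gmul _ _ GG GH; first exact: (YG None).
    by left; exists c.
  have YGmul G Q' : Gam G -> Y Q' -> Y (fmul op G Q').
    move=> GG [[y ->]|[[y|] [H [GH ->]]]] /=; [|  |exact: YGG].
      by rewrite commG //; exact: (YG (Some y)).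
    by rewrite fmulA // commG // -fmulA //; apply: Ypure; exact: YGG.
  case=> [[x ->]|[[x|] [G [GG ->]]]] YQ /=; [exact: Ypure| |exact: YGmul].
  by rewrite -fmulA //; apply: Ypure; exact: YGmul.
apply: (TzS_closed_filters opA clX _ _ Ymul _ (YG None F GF)).
- move=> _ [[x ->]|[w [G [GG ->]]]]; first exact: fpure_proper.
  by apply: fshift_proper; exact: Gproper.
- by move=> x; left; exists x.
- move=> _ A [[x ->] Ax|[w [G [GG ->]]] GA].
    exists [set x]; split => //; first by move=> _ ->.
    move=> _ [[y ->]|[w [G [GG ->]]]]; [exact: dpure|exact: Gpoint].
  have [B [GB BA dB]] := Gbase w G A GG GA; exists B; split => //.
  by move=> _ [[y ->]|[w' [G' [GG' ->]]]]; [exact: dpure|exact: dB].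
Qed.

Lemma fshift_ultra o U A : UltraFilter U -> fshift o U A \/ fshift o U (~` A).
Proof.
move=> UU; have [UA|UA] := in_ultra_setVsetC [set y | A (shift o y)] UU.
  by left; apply/fshiftP.
by right; apply/fshiftP.
Qed.

(** Translates of an ultrafilter decide every set, so only closure under products has to be
    assumed. *)
Lemma TzS_closed_ultra (U : set_system X) : C_closed TzS op ->
    UltraFilter U -> U (center op) ->
    fmul op U U = U \/ (exists c, fmul op U U = fpure c) ->
  exists x, U [set x].
Proof.
move=> clX UU Uc UU2; apply: (@TzS_closed_central_filters [set U]) => //.
- by move=> _ ->; exact: ultra_proper.
- by move=> F ->.
- by move=> F G -> ->.
- by move=> o G x ->; exact: fshift_ultra.
- move=> o G A -> UA; exists A; split => // o' G' ->; exact: fshift_ultra.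
Qed.

End CentralFilters.

Lemma free_ultrafilter (T : Type) (A : set T) : infinite_set A ->
  exists U : set_system T, [/\ UltraFilter U, U A & forall x, ~ U [set x]].
Proof.
move=> Ainf; pose F : set_system T := [set C | finite_set (A `\` C)].
have PF : ProperFilter F.
  apply: Build_ProperFilter_ex => [C FC|].
    have : infinite_set C.
      move=> Cfin; apply: Ainf; have : finite_set ((A `\` C) `|` C).
        by rewrite finite_setU.
      apply: sub_finite_set => x Ax.
      by have [Cx|Cx] := pselect (C x); [right|left].
    exact: infinite_setN0.
  split.
  - by rewrite /F /= setDT; exact: finite_set0.
  - by move=> P Q FP FQ; rewrite /F /= setDIr finite_setU.
  - by move=> P Q PQ; apply: sub_finite_set; exact: setDS.
have [U [UU FU]] := ultraFilterLemma PF; exists U; split => //.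
  by apply: FU; rewrite /F /= setDv; exact: finite_set0.
move=> x Ux; have UnX : U (~` [set x]).
  apply: FU; apply: (@sub_finite_set _ _ [set x]); last exact: finite_set1.
  by move=> y [_ /=]; exact: contrapT.
by have [y []] := filter_ex (filterI Ux UnX).
Qed.

Section TzSClosedCenter.
Variables (X : Type) (op : X -> X -> X).
Hypotheses (opA : associative op) (clX : C_closed TzS op).

Lemma center_nonsingular (A : set X) c : infinite_set A -> A `<=` center op ->
  (forall a b, A a -> A b -> op a b = c) -> False.
Proof.
move=> /free_ultrafilter[U [UU UA Ufree]] Ac AA.
suff [x /Ufree//] : exists x, U [set x].
apply: (TzS_closed_ultra opA clX); first exact: filterS UA.
right; exists c; apply/seteqP; split=> C; last first.
  by move=> Cc; exists A, A; split => // a b Aa Ab; rewrite AA.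
move=> [P [Q [UP UQ PQ]]].
have [a [Aa Pa]] := filter_ex (filterI UA UP).
have [b [Ab Qb]] := filter_ex (filterI UA UQ).
by rewrite /fpure /= -(AA a b) //; apply: PQ.
Qed.

Lemma center_chain_finite (A : set X) : infinite_set A -> A `<=` center op ->
  (forall a b, A a -> A b -> op a b = a \/ op a b = b) -> False.
Proof.
move=> /free_ultrafilter[U [UU UA Ufree]] Ac AA.
suff [x /Ufree//] : exists x, U [set x].
apply: (TzS_closed_ultra opA clX); first exact: filterS UA.
(* [U] is maximal, so its inclusion in [fmul U U] is enough. *)
left; apply: max_filter; first by apply: fmul_proper; exact: ultra_proper.
move=> C UC; exists (A `&` C), (A `&` C); split; [exact: filterI|exact: filterI|].
by move=> a b [Aa Ca] [Ab Cb]; have [->|->] := AA a b Aa Ab.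
Qed.

End TzSClosedCenter.

(** * Periodicity of the center *)

(* Without a unit, [npow op x 0] is the junk value [x]. *)
Definition npow (X : Type) (op : X -> X -> X) (x : X) (n : nat) : X :=
  iter n.-1 (op x) x.

Section Powers.
Variables (X : Type) (op : X -> X -> X).
Hypothesis opA : associative op.
Local Notation pw := (npow op).

Lemma pw1 x : pw x 1 = x. Proof. by []. Qed.

Lemma pwS x n : 0 < n -> pw x n.+1 = op x (pw x n).
Proof. by case: n. Qed.

Lemma pwSS x n : pw x n.+2 = op x (pw x n.+1). Proof. by []. Qed.

Lemma pwD x m n : 0 < m -> 0 < n -> op (pw x m) (pw x n) = pw x (m + n).
Proof.
case: m => [//|m] _ n0; elim: m => [|m IH]; first by rewrite pw1 add1n pwS.
by rewrite pwS // -opA IH [in RHS]addSn pwS // addn_gt0 n0 orbT.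
Qed.

Lemma pwM x m n : 0 < m -> 0 < n -> pw (pw x m) n = pw x (m * n).
Proof.
move=> m0; case: n => [//|n] _; elim: n => [|n IH]; first by rewrite muln1.
by rewrite pwS // IH pwD ?muln_gt0 ?m0 // [in RHS]mulnS.
Qed.

Lemma pw_idem e n : op e e = e -> pw e n = e.
Proof. by case: n => [//|n] ee; elim: n => [//|n IH]; rewrite pwS // IH. Qed.

Lemma center_op x y : center op x -> center op y -> center op (op x y).
Proof. by move=> cx cy a; rewrite opA cx -opA cy opA. Qed.

Lemma center_pw x n : center op x -> center op (pw x n).
Proof.
move=> cx; case: n => [//|n]; elim: n => [//|n IH].
by rewrite pwS //; exact: center_op.
Qed.

End Powers.

Lemma fact_dvd m n : m <= n -> m`! %| n`!.
Proof.
by move=> mn; rewrite -(bin_fact mn) mulnCA dvdn_mulr.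
Qed.

Section CenterPeriodic.
Variables (X : Type) (op : X -> X -> X) (z : X).
Hypotheses (opA : associative op) (zc : center op z).

(** Exponents along which the powers of [z] are followed: [L n] is closed under addition, and its
    elements differ by multiples of [n!], hence of any period up to [n]. The condition [0 < m]
    excludes the junk power. *)
Let L n m := [&& n`! %| m, n <= m & 0 < m].

Let LD n m m' : L n m -> L n m' -> L n (m + m').
Proof.
move=> /and3P[d1 l1 p1] /and3P[d2 l2 p2]; apply/and3P; split; [|lia|lia].
by rewrite dvdn_add.
Qed.

Let Lsub a n m : a <= n -> L n m -> L a m.
Proof.
move=> an /and3P[d l p]; apply/and3P; split; [|lia|lia].
exact: dvdn_trans (fact_dvd an) d.
Qed.

Let Lwit n : L n (n`! * n.+1).
Proof.
rewrite /L; have := fact_gt0 n; move: (n`!) (dvdnn n`!) => k dk k0.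
by apply/and3P; split; [exact: dvdn_mulr|nia|nia].
Qed.

Let F : set_system X := [set C | exists n, forall m, L n m -> C (npow op z m)].

Let PF : ProperFilter F.
Proof.
apply: Build_ProperFilter_ex => [C [n nC]|].
  by exists (npow op z (n`! * n.+1)); exact: nC _ (Lwit n).
split; first by exists 0.
  move=> P Q [a aP] [b bQ]; exists (maxn a b) => m Lm.
  by split; [apply: aP|apply: bQ]; apply: Lsub Lm; lia.
by move=> P Q PQ [n nP]; exists n => m /nP /PQ.
Qed.

Let FshiftP o C : fshift op o F C <-> F [set y | C (shift op o y)].
Proof. by apply: fshiftP; exact: PF. Qed.

Let FF : fmul op F F = F.
Proof.
apply/seteqP; split=> C.
  move=> [A [B [[a aA] [b bB] AB]]].
  (* An exponent [m] in [L (k + n.+1)] splits as [k + (m - k)] with both terms in [L n]. *)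
  pose n := maxn a b; pose k := n`! * n.+1; exists (k + n.+1) => m Lm.
  have Lk := Lwit n; have /and3P[dk kn k0] := Lk; rewrite -/k in Lk dk kn k0.
  have /and3P[dm mn m0] := Lm.
  have Lmk : L n (m - k).
    apply/and3P; split; [|lia|lia]; apply: dvdn_sub => //.
    by apply: dvdn_trans dm; apply: fact_dvd; lia.
  have -> : m = k + (m - k) by lia.
  rewrite -pwD //; last lia.
  by apply: AB; [apply: aA; apply: Lsub Lk|apply: bB; apply: Lsub Lmk]; lia.
move=> [n nC].
pose A := [set y | exists2 m, L n m & y = npow op z m].
exists A, A; split; [by exists n => m ?; exists m| by exists n => m ?; exists m|].
move=> _ _ [m Lm ->] [m' Lm' ->]; rewrite pwD //; first exact: nC _ (LD Lm Lm').
- by case/and3P: Lm.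
- by case/and3P: Lm'.
Qed.

Let al o m := shift op o (npow op z m).

Let alD o m k : 0 < m -> 0 < k -> op (al o m) (npow op z k) = al o (m + k).
Proof. by case: o => [x|] m0 k0; rewrite /al /= -?opA pwD. Qed.

(** One coincidence [al o' m = al o l] spreads: multiplying by z^(m' - m) puts [al o' m'] in [B] for
    all later [m'] in [L n]. *)
Let decL o o' n : let B := [set al o l | l in L n] in
  fshift op o' F B \/ fshift op o' F (~` B).
Proof.
move=> B; have [[m [l [Lm Ll E]]]|H] :=
    pselect (exists m l, [/\ L n m, L n l & al o' m = al o l]).
  left; apply/FshiftP; exists (maxn n m) => m' Lm' /=; rewrite -/(al o' m').
  have [<-|mm'] := eqVneq m m'; first by exists l.
  have /and3P[d1 l1 p1] := Lm; have /and3P[d2 l2 p2] := Ll.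
  have /and3P[d3 l3 p3] : L n m' by apply: Lsub Lm'; lia.
  have {}Lm' : m <= m' by case/and3P: Lm'; lia.
  have k0 : 0 < m' - m by lia.
  exists (l + (m' - m)); last by rewrite -alD // -E alD // subnKC.
  by apply/and3P; split; [apply: dvdn_add => //; exact: dvdn_sub|lia|lia].
right; apply/FshiftP; exists n => m Lm [l Ll E].
by apply: H; exists m, l.
Qed.

(** If [x] recurs in every [L N], two of its exponents differ by some [d], so z^d fixes [x]; then
    [x] is the value at all late exponents in [L d]. *)
Let decpt o x : fshift op o F [set x] \/ fshift op o F (~` [set x]).
Proof.
have [H|] := pselect (forall N, exists2 m, L N m & al o m = x); last first.
  move=> /existsNP[N NH]; right; apply/FshiftP; exists N => m Lm E.
  by apply: NH; exists m.
left; apply/FshiftP.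
have [m0 Lm0 E0] := H 0; have [m1 Lm1 E1] := H m0.+1.
have /and3P[_ _ m00] := Lm0; have /and3P[_ m10 _] := Lm1.
pose d := m1 - m0; have d0 : 0 < d by rewrite /d; lia.
have xd k : 0 < k -> op x (npow op z (d * k)) = x.
  have x1 : op x (npow op z d) = x.
    by rewrite -{1}E0 alD // -E1; congr (al o _); rewrite /d; lia.
  case: k => [//|k] _; elim: k => [|k IH]; first by rewrite muln1.
  by rewrite mulnS -pwD ?muln_gt0 ?d0 // opA x1.
have [m2 Lm2 E2] := H d; exists (maxn d m2) => m Lm; rewrite /= -/(al o m).
have /and3P[d1 l1 p1] := Lm2.
have /and3P[d2 l2 p2] : L d m by apply: Lsub Lm; lia.
have [<-//|mm'] := eqVneq m2 m.
have {}Lm : m2 <= m by case/and3P: Lm; lia.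
have dd : d %| d`! by apply: dvdn_fact; lia.
have /dvdnP[k kE] : d %| m - m2 by apply: dvdn_sub; exact: dvdn_trans dd _.
have -> : m = m2 + (m - m2) by lia.
by rewrite -alD //; [rewrite E2 kE mulnC xd //; lia|lia].
Qed.

Lemma center_periodic : C_closed TzS op ->
  exists2 n, 0 < n & op (npow op z n) (npow op z n) = npow op z n.
Proof.
move=> clX; have [x [n nx]] : exists x, F [set x].
  apply: (@TzS_closed_central_filters _ op opA [set F] clX) => //.
  - by move=> _ ->.
  - by move=> _ ->; exists 0 => m _; exact: center_pw.
  - by move=> _ _ -> ->; left.
  - by move=> o _ x ->; exact: decpt.
  - move=> o _ C -> /FshiftP[n nC]; exists [set al o l | l in L n]; split.
    + by apply/FshiftP; exists n => m Lm; exists m.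
    + by move=> _ [l Ll <-]; exact: nC.
    + by move=> o' _ ->; exact: decL.
have Lk := Lwit n; move: (n`! * n.+1) Lk => k Lk; have /and3P[_ _ k0] := Lk.
(* Both [k] and [k + k] lie in [L n], so z^k and z^(2k) equal [x]. *)
by exists k => //; rewrite pwD // (nx _ (LD Lk Lk)) (nx _ Lk).
Qed.

End CenterPeriodic.

(** * Commutative semigroups *)

Lemma filter_finite_setC (T : Type) (F : set_system T) (A : set T) :
  Filter F -> finite_set A -> (forall s, A s -> F (~` [set s])) -> F (~` A).
Proof.
elim/Pchoice: T => T in F A *.
move=> FF /finite_fsetP[D ->] FD.
have := @filter_bigI _ _ D (fun s => ~` [set s]) F FF FD.
by apply: filterS => x Dx Ax; apply: (Dx x Ax).
Qed.

Lemma finite_set_bound (T : Type) (A : set T) (P : T -> nat -> Prop) :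
  finite_set A -> (forall a, A a -> exists k, P a k) ->
  exists K, forall a, A a -> exists2 k, k <= K & P a k.
Proof.
elim/Pchoice: T => T in A P *.
move=> /finite_fsetP[D AD] AP.
have H a : A a -> \oo [set K | exists2 k, k <= K & P a k].
  by move=> /AP[k Pk]; exists k => // K kK; exists k.
rewrite AD in H *; have [K HK] := filter_ex (@filter_bigI _ _ D _ _ _ H).
by exists K => a; exact: HK.
Qed.

Section SemigroupProperties.
Variables (S : Type) (op : S -> S -> S).

Definition chain_finite := forall A : set S, infinite_set A ->
  ~ forall a b, A a -> A b -> op a b = a \/ op a b = b.

Definition nonsingular := forall (A : set S) c, infinite_set A ->
  ~ forall a b, A a -> A b -> op a b = c.

Definition periodic := forall x, exists2 n, 0 < n &
  op (npow op x n) (npow op x n) = npow op x n.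

(* In a periodic commutative semigroup this is the maximal subgroup with
   identity [e]. *)
Definition in_group (e h : S) := op h e = h /\ exists2 k, 0 < k & npow op h k = e.

Definition group_bounded := forall e, op e e = e ->
  exists2 n, 0 < n & forall h, in_group e h -> npow op h n = e.

End SemigroupProperties.

Section CommutativeSemigroup.
Variables (S : Type) (op : S -> S -> S).
Hypotheses (opA : associative op) (opC : commutative op).
Local Notation "x ** y" := (op x y) (at level 40, left associativity).
Local Notation pw := (npow op).

Lemma opCA : left_commutative op.
Proof. by move=> x y z; rewrite opA (opC x) -opA. Qed.

Lemma opAC : right_commutative op.
Proof. by move=> x y z; rewrite -opA (opC y) opA. Qed.

Lemma opACA : interchange op op.
Proof. by move=> x y z w; rewrite -!opA (opCA y). Qed.

Lemma pwMl x y n : pw (x ** y) n = pw x n ** pw y n.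
Proof.
case: n => [//|n]; elim: n => [//|n IH].
by rewrite !pwSS IH opACA.
Qed.

Lemma eq_op_pw x b b' k : x ** b = x ** b' -> x ** pw b k = x ** pw b' k.
Proof.
move=> xb; case: k => [//|k]; elim: k => [//|k IH].
by rewrite !pwSS !opA xb !(opAC x b') IH.
Qed.

(** Otherwise dependent choice gives a strictly [R]-decreasing sequence, whose range is an infinite
    chain. A general [R] serves for both minimal and maximal idempotents. *)
Lemma chain_extremum (R : S -> S -> Prop) (P : set S) x0 : chain_finite op ->
    (forall x, P x -> R x x) -> (forall x y z, R x y -> R y z -> R x z) ->
    (forall x y, R x y -> R y x -> x = y) ->
    (forall x y, R x y -> x ** y = x \/ x ** y = y) ->
  P x0 -> exists2 m, P m & forall g, P g -> R g m -> g = m.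
Proof.
move=> cf Rxx Rtr Ranti Rop Px0; apply: contrapT => noext.
have H (x : {x | P x}) : {y : {x | P x} | R (sval y) (sval x) /\ sval y <> sval x}.
  apply: cid; apply: contrapT => nH; apply: noext; exists (sval x); first exact: svalP.
  move=> g Pg Rg; apply: contrapT => gx; apply: nH.
  by exists (exist _ g Pg).
have [f [f0 fS]] := dependent_choice H (exist _ x0 Px0).
pose g n := sval (f n).
have gmono i j : i <= j -> R (g j) (g i).
  move=> ij; rewrite -(subnKC ij); elim: (j - i) => [|k IH].
    by rewrite addn0; apply: Rxx; exact: svalP.
  by rewrite addnS; apply: Rtr IH; have [] := fS (i + k).
have ginj : injective g.
  suff ginj' i j : i < j -> g i <> g j.
    by move=> i j gij; have [/ginj'|/ginj'|] := ltngtP i j; rewrite ?gij.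
  move=> ij gij; have [Ri ne] := fS i; apply: ne; apply: Ranti => //.
  by rewrite -[sval (f i)]/(g i) gij; exact: gmono.
apply: (cf (range g)).
  move=> gfin; apply: infinite_nat.
  have <- : g @^-1` range g = setT by apply/seteqP; split => // n _; exists n.
  by apply: finite_preimage gfin => i j _ _ /ginj.
move=> _ _ [i _ <-] [j _ <-]; have [/gmono/Rop//|/ltnW/gmono/Rop] := leqP j i.
by rewrite opC => -[->|->]; [right|left].
Qed.

(** Minimality refers to the natural order of idempotents, in which [g] is below [m] when
    [g ** m = g]. *)
Lemma min_idem (P : set S) x0 : chain_finite op ->
    (forall x, P x -> x ** x = x) -> P x0 ->
  exists2 m, P m & forall g, P g -> g ** m = g -> g = m.
Proof.
move=> cf Pid Px0; apply: (@chain_extremum (fun x y => x ** y = x) P x0 cf) => //.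
- by move=> x y z xy yz; rewrite -xy -opA yz.
- by move=> x y xy yx; rewrite -xy opC.
- by left.
Qed.

Lemma max_idem (P : set S) x0 : chain_finite op ->
    (forall x, P x -> x ** x = x) -> P x0 ->
  exists2 m, P m & forall g, P g -> m ** g = m -> g = m.
Proof.
move=> cf Pid Px0; apply: (@chain_extremum (fun x y => y ** x = y) P x0 cf) => //.
- by move=> x y z yx zy; rewrite -zy -opA yx.
- by move=> x y yx xy; rewrite -xy opC.
- by move=> x y yx; right; rewrite opC.
Qed.

Section Pi.
Variable pi : S -> S.
Hypotheses (pi_pw : forall x, exists2 n, 0 < n & pw x n = pi x)
  (pi_idem : forall x, pi x ** pi x = pi x).

Lemma pi_uniq x e n : 0 < n -> e ** e = e -> pw x n = e -> pi x = e.
Proof.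
move=> n0 ee xe; have [m m0 xm] := pi_pw x.
rewrite -(pw_idem n (pi_idem x)) -xm pwM // mulnC -pwM // xe.
exact: pw_idem.
Qed.

Lemma pi_id e : e ** e = e -> pi e = e.
Proof. by move=> ee; apply: (@pi_uniq e e 1). Qed.

Lemma piM x y : pi (x ** y) = pi x ** pi y.
Proof.
have [m m0 xm] := pi_pw x; have [n n0 yn] := pi_pw y.
apply: (@pi_uniq _ _ (m * n)); first by rewrite muln_gt0 m0.
  by rewrite opACA !pi_idem.
rewrite pwMl -pwM // xm pw_idem // mulnC -pwM // yn.
by rewrite pw_idem.
Qed.

End Pi.
End CommutativeSemigroup.

(** * Convergent filters *)

Section ConvergentFilters.
Variables (S : Type) (op : S -> S -> S).
Hypotheses (opA : associative op) (opC : commutative op).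
Local Notation "x ** y" := (op x y) (at level 40, left associativity).
Local Notation pw := (npow op).
Local Notation fmul := (fmul op).

Hypotheses (cf : chain_finite op) (ns : nonsingular op) (gb : group_bounded op).
Variable pi : S -> S.
Hypotheses (pi_pw : forall x, exists2 n, 0 < n & pw x n = pi x)
  (pi_idem : forall x, pi x ** pi x = pi x).
Let piM := piM opA opC pi_pw pi_idem.
Let pi_uniq := pi_uniq opA pi_pw pi_idem.
Let pi_id := pi_id opA pi_pw pi_idem.

(** Abstracts the filters on [S] that converge in the ambient T1 semigroup. [Conv_point] combines T1
    (the limit must be the image of [s]) with discreteness (that image is isolated in the range). *)
Variable Conv : set (set_system S).
Hypotheses (Conv_proper : forall F, Conv F -> ProperFilter F)
  (Conv_pure : forall s, Conv (fpure s))
  (Conv_mul : forall F G, Conv F -> Conv G -> Conv (fmul F G))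
  (Conv_finer : forall F G, Conv F -> ProperFilter G -> F `<=` G -> Conv G)
  (Conv_point : forall F s, Conv F -> (forall A, F A -> A s) -> F [set s]).

Definition free (F : set_system S) := forall s, ~ F [set s].

(** That is, the translate of [F] by [x] is principal; see [collapsesP]. *)
Definition collapses (x : S) (F : set_system S) :=
  exists s, F [set y | x ** y = s].

(** By [Conv_point], a free [F] contains the complement of every point, hence of every finite
    set. *)
Lemma Conv_free_infinite F A : Conv F -> free F -> F A -> infinite_set A.
Proof.
move=> CF fF FA Afin; have PF := Conv_proper CF.
have FnA : F (~` A).
  apply: filter_finite_setC => // s _; apply: contrapT => Fns.
  apply: (fF s); apply: Conv_point => // B FB; apply: contrapT => Bs.
  by apply: Fns; apply: filterS FB => y By ys; apply: Bs; rewrite -ys.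
by have [x []] := filter_ex (filterI FA FnA).
Qed.

Lemma Conv_free_finer F G : Conv F -> free F -> ProperFilter G -> F `<=` G ->
  free G.
Proof.
move=> CF fF PG FG s Gs; apply: (fF s); apply: Conv_point => // A /FG GA.
by have [x [Ax <-]] := filter_ex (filterI GA Gs).
Qed.

(** Otherwise some infinite member of [F] would have all its products equal to [s], against
    nonsingularity. *)
Lemma free_fmul F : Conv F -> free F -> free (fmul F F).
Proof.
move=> CF fF s [A [B [FA FB AB]]]; have PF := Conv_proper CF.
apply: (ns (Conv_free_infinite CF fF (filterI FA FB))) => a b [Aa _] [_ Bb].
exact: AB.
Qed.

Lemma Conv_pw F n : Conv F -> Conv (npow fmul F n).
Proof.
move=> CF; case: n => [//|n]; elim: n => [//|n IH].
by rewrite pwSS; exact: Conv_mul.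
Qed.

(** The exponents are powers of two because [free_fmul] handles squares only. *)
Lemma free_pw F j : Conv F -> free F -> free (npow fmul F (2 ^ j)).
Proof.
move=> CF fF; elim: j => [//|j IH].
have j0 : 0 < 2 ^ j by rewrite expn_gt0.
rewrite expnS mul2n -addnn -pwD //; last by move=> P Q R; exact: fmulA.
by apply: free_fmul => //; exact: Conv_pw.
Qed.

Lemma pw_filter_diag F n A : Filter F -> npow fmul F n A ->
  F [set y | A (pw y n)].
Proof.
move=> FF; case: n => [//|n]; elim: n A => [//|n IH] A.
move=> [P [Q [FP /IH FQ PQ]]]; apply: filterS (filterI FP FQ) => y [Py Qy].
exact: PQ.
Qed.

Lemma collapsesP x F : Filter F ->
  collapses x F <-> exists s, fmul (fpure x) F [set s].
Proof.
by move=> FF; split=> -[s]; [move=> Fs|move=> /fmul_pureP Fs]; exists s => //;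
  apply/fmul_pureP.
Qed.

Lemma Conv_nfree_shift x F : Conv F -> ~ collapses x F ->
  Conv (fmul (fpure x) F) /\ free (fmul (fpure x) F).
Proof.
move=> CF nc; have PF := Conv_proper CF; split; first exact: Conv_mul.
by move=> s Fs; apply: nc; apply/collapsesP; exists s.
Qed.

(** If every member of [W] met the group of [f], the common exponent k + 1 would put [f] in all
    members of W^(k+1), making it principal. Then a x^k = f on a member of [W], for some group
    element [x]; so [a = x] there and [W] is principal. *)
Lemma group_not_often W f : Conv W -> free W -> f ** f = f ->
  W [set y | f ** y = y] -> exists2 C, W C & forall x, C x -> ~ in_group op f x.
Proof.
move=> CW fW ff Wf; have PW := Conv_proper CW.
(* Doubling the exponent [n] makes [k] positive, so W^(k+1) splits as W times W^k. *)
have [n n0 gn] := gb ff; pose k := n.*2.-1.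
have nk : n.*2 = k.+1 by rewrite /k; lia.
have gk h : in_group op f h -> pw h k.+1 = f.
  by move=> /gn hn; rewrite -nk -addnn -pwD // hn.
apply: contrapT => often.
have oftenW C : W C -> exists2 x, C x & in_group op f x.
  move=> WC; apply: contrapT => nC; apply: often; exists C => // x Cx gx.
  by apply: nC; exists x.
have : npow fmul W k.+1 [set f].
  apply: Conv_point; first exact: Conv_pw.
  by move=> C /pw_filter_diag/oftenW[x /= + /gk xf]; rewrite xf.
have k0 : 0 < k by rewrite /k; lia.
rewrite pwS // => -[A [B [WA /pw_filter_diag WB AB]]].
have [x [Ax [Bx fx]] [xf _]] := oftenW _ (filterI WA (filterI WB Wf)).
apply: (fW x); apply: filterS (filterI WA Wf) => a [Aa fa] /=.
have af : a ** pw x k = f by exact: AB.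
have xk : pw x k.+1 = f by rewrite pwS //; exact: AB.
by rewrite -fa opC -xk pwS // opA [a ** x]opC -opA af.
Qed.

(* Multiplying by a minimal idempotent that keeps the filter free makes all
   smaller idempotents collapse it, and boundedness keeps it out of [H_f]. *)
Lemma reduce_collapsing F : Conv F -> free F ->
  exists W, [/\ Conv W, free W & W [set x | collapses (pi x) W]].
Proof.
move=> CF fF; have PF := Conv_proper CF.
have [[f0 f00 nf0]|allc] := pselect (exists2 f, f ** f = f & ~ collapses f F);
  last first.
  exists F; split => //; apply: (@filterS _ _ _ setT) => [x _|]; last exact: filterT.
  by apply: contrapT => nc; apply: allc; exists (pi x).
have [f [ff nf] fmin] := @min_idem _ op opA opC
  [set f | f ** f = f /\ ~ collapses f F] f0 cf (fun x => @proj1 _ _) (conj f00 nf0).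
have [CW fW] := Conv_nfree_shift CF nf; set W := fmul _ _ in CW fW.
have PW := Conv_proper CW.
have Wf : W [set y | f ** y = y].
  by apply/fmul_pureP; apply: filterS filterT => y _ /=; rewrite opA ff.
have [C WC nC] := group_not_often CW fW ff Wf.
exists W; split => //; apply: filterS (filterI WC Wf) => x [Cx fx].
have pif : pi x ** f = pi x by rewrite -{2}fx piM (pi_id ff) opC.
have npif : pi x <> f.
  move=> xf; apply: (nC x Cx); split; first by rewrite opC.
  by have [n n0 xn] := pi_pw x; exists n; rewrite // xn.
have : collapses (pi x) F.
  by apply: contrapT => nc; apply: npif; apply: fmin.
move=> [s Fs]; exists s; apply/fmul_pureP.
by apply: filterS Fs => y /= <-; rewrite opA pif.
Qed.

(** [e] is maximal among the collapsing idempotents below [pi b] for [W]-most [b]. For [W]-most [x],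
    [pi x ** pi b] has a constant value [h] on [W]-most [b], and extremality forces [h = e]. *)
Lemma collapsed_idem W : Conv W -> W [set x | collapses (pi x) W] ->
  exists e, [/\ e ** e = e, collapses e W, W [set b | e ** pi b = e] &
    W [set x | W [set b | pi x ** pi b = e]]].
Proof.
move=> CW WA0; have PW := Conv_proper CW.
pose G g := g ** g = g /\ collapses g W.
pose P k := G k /\ W [set b | k ** pi b = k].
have collM g h : collapses g W -> collapses (h ** g) W.
  move=> [s Ws]; exists (h ** s); apply: filterS Ws => y /= <-.
  by rewrite -opA.
(* Where [g ** b] has the constant value [s], [g ** pi b = pi (g ** b)] has the constant value
   [pi s]. *)
have key g : G g -> exists2 h, P h & W [set b | g ** pi b = h].
  move=> [gg cg]; have [s Ws] := cg.
  have Wh : W [set b | g ** pi b = pi s].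
    by apply: filterS Ws => b /= <-; rewrite piM (pi_id gg).
  exists (pi s) => //; split; first split => //.
    have [b /= <-] := filter_ex Wh.
    by rewrite opC; exact: collM.
  by apply: filterS Wh => b /= <-; rewrite -opA pi_idem.
have [x0 cx0] := filter_ex WA0.
have [h0 Ph0 _] := key (pi x0) (conj (pi_idem x0) cx0).
have [e [[ee ce] We] emax] := @max_idem _ op opA opC P h0 cf
  (fun x => fun Px => proj1 (proj1 Px)) Ph0.
exists e; split => //; apply: filterS (filterI WA0 We) => x [cx ex].
have [h [[hh ch] Wh] Wxh] := key (pi x) (conj (pi_idem x) cx).
suff he : h ** e = h.
  apply: filterS (filterI Wxh We) => b [/= xb eb].
  by rewrite xb -he -xb opC opA ex eb.
have hx : h ** pi x = h.
  by have [b /= <-] := filter_ex Wxh; rewrite opAC // pi_idem.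
(* A minimal [k] in [P'] satisfies [k ** pi b = k] for [W]-most [b], so it lies in [P]; maximality
   of [e] gives [k = e], whence [h ** e = h]. *)
pose P' k := [/\ G k, h ** k = h & e ** k = e].
have [k [[kk ck] hk ek] kmin] := @min_idem _ op opA opC P' (pi x) cf
  (fun x => fun Px => proj1 (let: And3 a _ _ := Px in a))
  (And3 (conj (pi_idem x) cx) hx ex).
suff Pk : P k by rewrite -(emax k Pk ek).
split => //; apply: filterS (filterI Wh We) => b [hb eb].
apply: kmin; last by rewrite opAC // kk.
split; [split; first by rewrite opACA // kk pi_idem| |].
- by rewrite opC //; exact: collM.
- by rewrite opA hk.
- by rewrite opA ek.
Qed.

(** For [W]-most [x], [pi (x ** b) = e] for [W]-most [b]. This set of [b] depends on [x], so [D] is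
    only known to meet every member of the square of [W], and [V] is the restriction of that square
    to [D]. *)
Lemma concentrate W : Conv W -> free W -> W [set x | collapses (pi x) W] ->
  exists V e t, [/\ Conv V, free V, e ** e = e, e ** t = t &
    V [set z | pi z = e /\ e ** z = t]].
Proof.
move=> CW fW WA0; have PW := Conv_proper CW.
have [e [ee [t0 Wt0] We Wxe]] := collapsed_idem CW WA0.
have CWW := Conv_mul CW CW; have PWW := Conv_proper CWW.
pose D := [set z | pi z = e]; pose V := within D (fmul W W).
have PV : ProperFilter V.
  apply: Build_ProperFilter_ex.
  move=> C [A [B [WA WB AB]]].
  have [x [Ax Wx]] := filter_ex (filterI WA Wxe).
  have [b [Bb xb]] := filter_ex (filterI WB Wx).
  by exists (x ** b); apply: AB => //; rewrite /D /= piM.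
have WV : fmul W W `<=` V by move=> A WA; apply: filterS WA => z.
have CV : Conv V := Conv_finer CWW PV WV.
exists V, e, (t0 ** t0); split => //.
- exact: Conv_free_finer CWW (free_fmul CW fW) PV WV.
- by have [y /= <-] := filter_ex Wt0; rewrite !opA ee.
- have VD : V D by exact: withinT.
  apply: filterI => //; apply: WV.
  exists [set y | e ** y = t0], [set y | e ** y = t0]; split => //.
  by move=> a b /= ea eb; rewrite -{1}ea -eb opACA // ee.
Qed.


(* If [x^n V] were free while [x^(n+1) V] collapses, the square of [x^n V] would be
   principal, against [free_fmul]. *)
Lemma collapses_pw_pred V x n : Conv V -> 0 < n ->
  collapses (pw x n.+1) V -> collapses (pw x n) V.
Proof.
move=> CV n0 [s Vs]; apply: contrapT => nc.
have [CZ fZ] := Conv_nfree_shift CV nc; set Z := fmul _ _ in CZ fZ.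
have PV := Conv_proper CV; have [b0 b0s] := filter_ex Vs.
pose B := [set b | pw x n.+1 ** b = s].
apply: (free_fmul CZ fZ (s := pw x (n + n) ** (b0 ** b0))).
have ZB : Z [set pw x n ** b | b in B].
  by apply/fmul_pureP; apply: filterS Vs => b Bb; exists b.
exists [set pw x n ** b | b in B], [set pw x n ** b | b in B]; split => //.
move=> _ _ [b Bb <-] [b' Bb' <-] /=.
have E c c' : B c -> B c' -> pw x (n + n) ** c = pw x (n + n) ** c'.
  (* For [n = 1] the exponent [n.-1] would give a junk power, but then [n + n] is already [n.+1]. *)
  rewrite /B /= => Bc Bc'; have [n1|n1] := eqVneq n 1.
    by rewrite n1 in Bc Bc' *; rewrite Bc Bc'.
  have -> : n + n = n.-1 + n.+1 by lia.
  by rewrite -pwD //; [rewrite -!opA Bc Bc'|lia].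
rewrite opACA // pwD // opA (E b b0) // -opA (opC b0) opA (E b' b0) // -opA.
Qed.

(** For [x] in [Q], x b^k enters [e S] at a least exponent [nx x], the same for [V]-most [b].
    Stopping about halfway gives elements [z x] still far from [e S] whose pairwise products have
    already entered it. *)
Lemma concentrated_not_free V e t : Conv V -> e ** e = e -> e ** t = t ->
  V [set z | pi z = e /\ e ** z = t] -> ~ free V.
Proof.
move=> CV ee et VQ fV; have PV := Conv_proper CV.
set Q : set S := [set z | _] in VQ.
(* Some power of [x] is [e], which collapses [V]; [collapses_pw_pred] descends to [x]. *)
have coll x : Q x -> collapses x V.
  move=> [xe ext]; have [n n0 xn] := pi_pw x; rewrite xe in xn.
  have : collapses (pw x n) V.
    by rewrite xn; exists t; apply: filterS VQ => z [].
  case: n n0 {xn} => [//|n] _; elim: n => [//|n IH] /collapses_pw_pred h.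
  exact: IH (h CV isT).
have /choice[s sP] : forall x, exists s, Q x -> V [set b | x ** b = s].
  move=> x; have [Qx|nQx] := pselect (Q x); last by exists x.
  by have [s Vs] := coll x Qx; exists s.
pose B x := [set b | Q b /\ x ** b = s x].
have VB x : Q x -> V (B x).
  by move=> Qx; apply: filterS (filterI VQ (sP x Qx)) => b [].
have /choice[b0 b0P] : forall x, exists b, Q x -> B x b.
  move=> x; have [Qx|nQx] := pselect (Q x); last by exists x.
  by have [b Bb] := filter_ex (VB x Qx); exists b.
pose p x k := x ** pw (b0 x) k.
have pE x b k : Q x -> B x b -> x ** pw b k = p x k.
  move=> Qx [_ xb]; apply: eq_op_pw => //.
  by have [_ ->] := b0P x Qx.
have et_pw k : e ** pw t k = pw t k.
  case: k => [//|k]; elim: k => [//|k IH]; by rewrite pwSS opA et.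
have e_pw b k : 0 < k -> e ** b = t -> e ** pw b k = pw t k.
  move=> + eb; case: k => [//|k] _; elim: k => [|k IH]; first by rewrite eb.
  by rewrite !pwSS -[in LHS]ee opACA // eb IH.
pose E x k := 0 < k /\ e ** p x k = p x k.
have pEv x k : Q x -> E x k -> p x k = pw t k.+1.
  move=> Qx [k0 <-]; have [[_ eb] _] := b0P x Qx; have [_ ex] := Qx.
  by rewrite /p -ee opACA // ex e_pw // pwS.
have Emono x k k' : k <= k' -> E x k -> E x k'.
  move=> kk' [k0 xk]; have [->//|ne] := eqVneq k' k.
  split; first lia.
  have -> : k' = k + (k' - k) by lia.
  have -> : p x (k + (k' - k)) = p x k ** pw (b0 x) (k' - k).
    by rewrite /p -pwD ?opA //; lia.
  by rewrite opA xk.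
have Eex x : Q x -> exists k, E x k.
  move=> Qx; have [[bx _] _] := b0P x Qx; have [k k0 bk] := pi_pw (b0 x).
  by exists k; split => //; rewrite /p bk bx opCA // ee.
have /choice[nx nxP] : forall x, exists n, Q x -> E x n /\ forall k, E x k -> n <= k.
  move=> x; have [Qx|nQx] := pselect (Q x); last by exists 0.
  by have [j [Ej jmin]] := nat_has_minimum (Eex x Qx); exists j.
have unbounded N : exists2 x, Q x & N < nx x.
  apply: contrapT => nN.
  have nxN x : Q x -> E x N.+1.
    move=> Qx; have [Ex _] := nxP x Qx; apply: Emono Ex; rewrite leqNgt.
    by apply/negP => Nx; apply: nN; exists x => //; lia.
  (* Now x b^(N+1) = t^M for [V]-most [x] and then [V]-most [b], so V^M is principal. So is V^k for
     all [k >= M], in particular for [k = 2 ^ M], against [free_pw]. *)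
  pose M := N.+2.
  have VM : npow fmul V M [set pw t M].
    apply: Conv_point; first exact: Conv_pw.
    rewrite /M pwSS => A [P [R [VP VR PR]]].
    have {}VR : V [set y | R (pw y N.+1)] by exact: pw_filter_diag VR.
    have [x [Px Qx]] := filter_ex (filterI VP VQ).
    have [b [Bb Rb]] := filter_ex (filterI (VB x Qx) VR).
    by rewrite -(pEv x) //; [rewrite -(pE x b) //; exact: PR|exact: nxN].
  have VM' k : M <= k -> npow fmul V k [set pw t k].
    move=> Mk; rewrite -(subnKC Mk); elim: (k - M) => [|j IH]; first by rewrite addn0.
    rewrite addnS pwS; last by rewrite /M.
    exists Q, [set pw t (M + j)]; split => //.
    move=> a _ [_ ea] -> /=.
    by rewrite pwS /M // -[in LHS]et_pw opCA // opA ea.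
  exact: (free_pw (j := M) CV fV (VM' _ (ltnW (ltn_expl M _)))).
have [ord o0 tO] : exists2 d, 0 < d & pw t d = e.
  have [x [xe ex]] := filter_ex VQ; have [n n0 tn] := pi_pw t.
  by exists n => //; rewrite tn -ex piM xe pi_id.
have tmul j : 0 < j -> pw t (ord * j) = e by move=> j0; rewrite -pwM // tO pw_idem.
(* About half of [nx x], with [(m x).+1] a multiple of [ord]. The summand 2 makes up for the
   rounding and the predecessor, so that [m x + m x] reaches [nx x]. *)
pose m x := (ord * (nx x %/ ord.*2 + 2)).-1.
have om x : (m x).+1 = ord * (nx x %/ ord.*2 + 2).
  by rewrite /m prednK // muln_gt0 o0 addn2.
have nx_mod x : nx x %% ord.*2 < ord.*2 by rewrite ltn_mod double_gt0.
have mlarge x : nx x <= m x + m x.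
  have := divn_eq (nx x) ord.*2; have := nx_mod x; have := om x; nia.
have msmall K x : 4 * ord + 2 * K < nx x -> m x + K < nx x.
  have := divn_eq (nx x) ord.*2; have := nx_mod x; have := om x; nia.
pose z x := p x (m x).
have m0 x : 0 < m x by have := om x; nia.
have Bz x b : Q x -> B x b -> z x = x ** pw b (m x).
  by move=> Qx Bb; rewrite pE.
pose A := [set z x | x in [set x | Q x /\ 4 * ord < nx x]].
have AA a a' : A a -> A a' -> a ** a' = e.
  suff H x x' : Q x -> Q x' -> nx x <= nx x' -> z x ** z x' = e.
    move=> [x [Qx _] <-] [x' [Qx' _] <-].
    by have [/H->//|/ltnW/H] := leqP (nx x) (nx x'); rewrite opC => ->.
  move=> Qx Qx' xx'; have [_ ex'] := Qx'.
  have [b [Bb Bb']] := filter_ex (filterI (VB x Qx) (VB x' Qx')).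
  have Ex : E x (m x + m x').
    by have [Ex _] := nxP x Qx; apply: Emono Ex; have := mlarge x; have := mlarge x'; lia.
  (* With a common [b], the product is (x b^(m x + m x')) x' = t^(m x + m x' + 1) x' = t^(m x + m x'
     + 2), which is [e] by the choice of [m]. *)
  rewrite (Bz x b) // (Bz x' b) // opACA // pwD // opAC // pE // pEv //.
  rewrite -et_pw opAC // ex' -pwSS.
  have -> : (m x + m x').+2 = (m x).+1 + (m x').+1 by lia.
  by rewrite -pwD // !om !tmul ?ee ?addn2.
apply: (ns _ AA) => Afin.
have big K : exists2 x, A (z x) & Q x /\ m x + K < nx x.
  have [x Qx xK] := unbounded (4 * ord + 2 * K); exists x.
    by exists x => //; split => //; lia.
  by split => //; exact: msmall.
(* For finite [A], one [K] bounds the number of further factors [b] that bring its elements into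
   [e S]; an [x] with [m x + K < nx x] contradicts this. *)
have [] := @finite_set_bound _ A (fun a k =>
  0 < k /\ V [set b | e ** (a ** pw b k) = a ** pw b k]) Afin.
  move=> _ [x [Qx _] <-]; have [Ex _] := nxP x Qx; have [nx0 _] := Ex.
  exists (nx x); split => //; apply: filterS (VB x Qx) => b Bb.
  have [_ xk] : E x (m x + nx x) by apply: Emono Ex; lia.
  by rewrite /= (Bz x b) // -opA pwD // pE.
move=> K AK; have [x Ax [Qx xK]] := big K.
have [k kK [k0 Vk]] := AK _ Ax; have [b [Bb bk]] := filter_ex (filterI (VB x Qx) Vk).
have [_ nmin] := nxP x Qx.
suff : nx x <= m x + k by lia.
apply: nmin; split; first lia.
by move: bk; rewrite /= (Bz x b) // -opA pwD // pE.
Qed.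

Lemma Conv_principal F : Conv F -> exists s, F [set s].
Proof.
move=> CF; apply: contrapT => nF.
have fF : free F by move=> s Fs; apply: nF; exists s.
have [W [CW fW Wc]] := reduce_collapsing CF fF.
have [V [e [t [CV fV ee et VQ]]]] := concentrate CW fW Wc.
exact: (concentrated_not_free CV ee et VQ fV).
Qed.

End ConvergentFilters.

(** * Closedness in T1 topological semigroups *)

Lemma periodic_idempotent_power (S : Type) (op : S -> S -> S) : periodic op ->
  exists pi : S -> S, (forall x, exists2 n, 0 < n & npow op x n = pi x) /\
    forall x, op (pi x) (pi x) = pi x.
Proof.
move=> per.
have /choice[pi piP] : forall x, exists e, op e e = e /\
    exists2 n, 0 < n & npow op x n = e.
  by move=> x; have [n n0 xn] := per x; exists (npow op x n); split => //; exists n.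
by exists pi; split => x; have [] := piP x.
Qed.

(** The neighbourhoods of a point [z] in the closure of the range trace a convergent filter on [S].
    It contains some [{s}] by [Conv_principal], and T1 then forces [z = h s]. *)
Lemma T1S_closed_of_commutative (S : Type) (op : S -> S -> S) :
  associative op -> commutative op -> chain_finite op -> nonsingular op ->
  periodic op -> group_bounded op -> C_closed T1S op.
Proof.
move=> opA opC cf ns per gb Y m [[mA mcont] T1] h hM [hinj hemb].
have [pi [pi_pw pi_idem]] := periodic_idempotent_power per.
have sep y s : y <> h s -> exists A, [/\ open A, A y & ~ A (h s)].
  move=> /eqP/T1[A [oA /set_mem Ay /set_mem nA]]; by exists A.
have isol s : exists2 V, nbhs (h s) V & forall x, V (h x) -> x = s.
  have [V [oV E]] := hemb [set s].
  have Vs : (V `&` range h) (h s) by rewrite -E; exists s.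
  exists V; first by apply: open_nbhs_nbhs; split => //; case: Vs.
  move=> x Vx; have : (h @` [set s]) (h x) by rewrite E; split => //; exists x.
  by move=> [_ -> /hinj].
pose Conv : set (set_system S) := [set F | ProperFilter F /\
  exists y : Y, forall V, nbhs y V -> F (h @^-1` V)].
have Conv_pr F : Conv F -> exists s, F [set s].
  apply: (@Conv_principal S op opA opC cf ns gb pi pi_pw pi_idem Conv).
  - by move=> G [].
  - move=> s; split; first exact: fpure_proper.
    by exists (h s) => V; exact: nbhs_singleton.
  - move=> G H [PG [y Gy]] [PH [z Hz]]; split; first exact: fmul_proper.
    exists (m y z) => V /(mcont (y, z))[[P Q] [/= yP zQ] PQ].
    exists (h @^-1` P), (h @^-1` Q); split; [exact: Gy|exact: Hz|].
    by move=> a b Pa Qb; rewrite /= hM; exact: (PQ (h a, h b)).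
  - by move=> G H [PG [y Gy]] PH GH; split => //; exists y => V /Gy/GH.
  - move=> G s [PG [y Gy]] Gs; have yhs : y = h s.
      apply: contrapT => /sep[A [oA Ay nA]]; apply: nA; apply: (Gs (h @^-1` A)).
      by apply: Gy; apply: open_nbhs_nbhs.
    have [V Vs Vx] := isol s; rewrite yhs in Gy.
    by apply: filterS (Gy V Vs) => x /Vx.
move=> z zcl.
pose F : set_system S := [set C | exists2 V, nbhs z V & h @^-1` V `<=` C].
have CF : Conv F.
  split; last by exists z => V zV; exists V.
  apply: Build_ProperFilter_ex => [C [V zV VC]|].
    by have [_ [[x _ <-] Vx]] := zcl V zV; exists x; exact: VC.
  split; first by exists setT => //; exact: filterT.
    move=> P Q [V zV VP] [W zW WQ]; exists (V `&` W); first exact: filterI.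
    by move=> x [Vx Wx]; split; [exact: VP|exact: WQ].
  by move=> P Q PQ [V zV VP]; exists V => // x /VP/PQ.
have [s [V zV Vs]] := Conv_pr F CF; exists s => //.
apply: contrapT => /nesym/sep[A [oA Az nA]]; apply: nA.
have [_ [[x _ <-] [Vx Ax]]] := zcl (V `&` A)
  (filterI zV (open_nbhs_nbhs (conj oA Az))).
by have <- : x = s by exact: Vs.
Qed.

(** * Bounded subgroups *)

Section Groups.
Variables (S : Type) (op : S -> S -> S).
Hypotheses (opA : associative op) (opC : commutative op).
Local Notation "x ** y" := (op x y) (at level 40, left associativity).
Local Notation pw := (npow op).
Local Notation in_group := (in_group op).

Definition bounded_at e := exists2 n, 0 < n & forall h, in_group e h -> pw h n = e.

Lemma pw_op_id u e j : u ** e = u -> pw u j ** e = pw u j.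
Proof.
move=> ue; case: j => [//|j]; elim: j => [//|j IH].
by rewrite pwSS -opA IH.
Qed.

Lemma in_group_op e a b : e ** e = e -> in_group e a -> in_group e b ->
  in_group e (a ** b).
Proof.
move=> ee [ae [j j0 aj]] [be [k k0 bk]]; split; first by rewrite -opA be.
exists (j * k); first by rewrite muln_gt0 j0.
by rewrite pwMl // -pwM // aj mulnC -pwM // bk !pw_idem.
Qed.

Lemma in_group_id e : e ** e = e -> in_group e e.
Proof. by move=> ee; split => //; exists 1. Qed.

Lemma in_group_pw e h n : e ** e = e -> in_group e h -> in_group e (pw h n).
Proof.
move=> ee eh; case: n => [//|n]; elim: n => [//|n IH].
by rewrite pwSS; exact: in_group_op.
Qed.

(** Further factors [h] turn [h] into h^k = e, so [a] and [b] need only lie in [e S]. *)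
Lemma in_group_cancel e h a b : in_group e h -> e ** a = a -> e ** b = b ->
  h ** a = h ** b -> a = b.
Proof.
move=> [_ [k k0 hk]] ea eb hab; rewrite -ea -eb -hk.
case: k k0 {hk} => [//|k] _; elim: k => [//|k IH].
by rewrite pwSS -!opA IH.
Qed.

Hypothesis ns : nonsingular op.
Variable pi : S -> S.
Hypotheses (pi_pw : forall x, exists2 n, 0 < n & pw x n = pi x)
  (pi_idem : forall x, pi x ** pi x = pi x).

(* For [a], [b] in [{u^j h^n}] the product does not depend on [a] and [b], so
   this set is finite and some further power of [h] fixes [u^j]. *)
Lemma fixed_by_powers_pred e u j n : e ** e = e -> u ** e = u -> 0 < j -> 0 < n ->
    (forall h, in_group e h -> pw u j.+1 ** pw h n = pw u j.+1) ->
  exists2 n', 0 < n' & forall h, in_group e h -> pw u j ** pw h n' = pw u j.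
Proof.
move=> ee ue j0 n0 fix1.
have fix2 h : in_group e h -> pw u (j + j) ** pw h n = pw u (j + j).
  move=> eh; have [j1|j1] := eqVneq j 1.
    by have := fix1 h eh; rewrite j1.
  have -> : j + j = j.-1 + j.+1 by lia.
  by rewrite -pwD //; [rewrite -opA fix1|lia].
pose A := [set pw u j ** pw h n | h in in_group e].
have Afin : finite_set A.
  apply: contrapT => Ainf; apply: (ns (c := pw u (j + j)) Ainf).
  move=> _ _ [h eh <-] [h' eh' <-].
  by rewrite opACA // pwD // opA fix2 // fix2.
(* [K] bounds exponents that kill representatives of the points of [A], so [K!] kills these
   representatives; [eq_op_pw] replaces [h] by one of them. *)
have [a [h eh <-]|K AK] := @finite_set_bound _ A (fun a k => 0 < k /\
  exists h, [/\ in_group e h, pw u j ** pw h n = a & pw h k = e]) Afin.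
  by have [_ [k k0 hk]] := eh; exists k; split => //; exists h.
exists (n * K`!) => [|h eh]; first by rewrite muln_gt0 n0 fact_gt0.
have [k kK [k0 [h' [eh' hh' h'k]]]] := AK _ (ex_intro2 _ _ h eh erefl).
have /dvdnP[d dE] : k %| K`! by rewrite dvdn_fact // k0.
have d0 : 0 < d by have := fact_gt0 K; rewrite dE muln_gt0 => /andP[].
rewrite -pwM ?fact_gt0 // -(eq_op_pw opA opC _ hh') pwM ?fact_gt0 //.
have -> : n * K`! = k * (d * n) by rewrite dE; nia.
by rewrite -pwM ?muln_gt0 ?d0 // h'k (pw_idem _ ee) (pw_op_id _ ue).
Qed.

(** Multiplication by [pi u], a power of [u], maps the group of [e] into that of [pi u], whose
    exponent [N] makes h^N fix [pi u]. Then [fixed_by_powers_pred] lowers the power of [u] to 1. *)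
Lemma fixed_by_powers e u : e ** e = e -> u ** e = u -> bounded_at (pi u) ->
  exists2 n, 0 < n & forall h, in_group e h -> u ** pw h n = u.
Proof.
move=> ee ue [N N0 bN].
have [q q0 uq] := pi_pw u.
have pie : pi u ** e = pi u by rewrite -uq pw_op_id.
have : exists2 n, 0 < n & forall h, in_group e h -> pw u q ** pw h n = pw u q.
  exists N => // h [he [k k0 hk]]; rewrite uq.
  rewrite -{1}(pw_idem N (pi_idem u)) -pwMl //; apply: bN; split.
    by rewrite opAC // pi_idem.
  by exists k; rewrite // pwMl // hk pw_idem.
case: q q0 {uq} => [//|q] _; elim: q => [//|q IH] [n n0 fixn].
by apply: IH; exact: fixed_by_powers_pred fixn.
Qed.

Variable e : S.
Hypotheses (ee : e ** e = e) (unb : ~ bounded_at e).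

(* [lac_order k] kills [g 0], ..., [g (k - 1)], and [g k] is a [k!]-th power with
   [g k ^ (c * lac_order k) <> e] for [1 <= c <= k]. *)
Lemma lacunary_sequence : exists (g : nat -> S) (lac_order : nat -> nat),
  [/\ forall k, in_group e (g k),
      forall k, exists2 h, in_group e h & g k = pw h k`!,
      forall k, 0 < lac_order k,
      forall i k, i < k -> pw (g i) (lac_order k) = e &
      forall c k, 0 < c <= k -> pw (g k) (c * lac_order k) <> e].
Proof.
have /choice[eta etaP] : forall N, exists h, 0 < N -> in_group e h /\ pw h N <> e.
  move=> N; have [N0|nN] := pselect (0 < N); last by exists e => /nN.
  apply: contrapT => nH; apply: unb; exists N => // h eh.
  by apply: contrapT => hN; apply: nH; exists h.
have /choice[tau tauP] : forall h, exists k, in_group e h -> 0 < k /\ pw h k = e.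
  move=> h; have [[he [k k0 hk]]|neh] := pselect (in_group e h); last by exists 0.
  by exists k.
(* [k!] occurs twice: once since [g k] is a [k!]-th power, once to absorb a factor [c <= k]. *)
pose fix ob k := if k is k'.+1 then ob k' * tau (eta (k'`! * k'`! * ob k')) else 1.
have ob0 k : 0 < ob k.
  elim: k => [//|k IH] /=; rewrite muln_gt0 IH /=.
  have [|eh _] := etaP (k`! * k`! * ob k); first by rewrite !muln_gt0 fact_gt0.
  by have [] := tauP _ eh.
pose et k := eta (k`! * k`! * ob k).
have etP k : in_group e (et k) /\ pw (et k) (k`! * k`! * ob k) <> e.
  by apply: etaP; rewrite !muln_gt0 fact_gt0 ob0.
have tau0 k : 0 < tau (et k) by have [eh _] := etP k; have [] := tauP _ eh.
exists (fun k => pw (et k) k`!), ob; split => //.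
- by move=> k; apply: in_group_pw => //; have [] := etP k.
- by move=> k; exists (et k) => //; have [] := etP k.
- move=> i k ik; have : tau (et i) %| ob k.
    elim: k ik => [//|k IH]; rewrite ltnS leq_eqVlt => /orP[/eqP<-|/IH H] /=.
      exact: dvdn_mull.
    exact: dvdn_mulr.
  move=> /dvdnP[d dE]; have d0 : 0 < d by have := ob0 k; rewrite dE muln_gt0 => /andP[].
  have [eh _] := etP i; have [_ ht] := tauP _ eh.
  have i0 := fact_gt0 i; rewrite pwM // dE.
  have -> : i`! * (d * tau (et i)) = tau (et i) * (d * i`!) by nia.
  by rewrite -pwM ?muln_gt0 ?d0 // ht pw_idem.
- move=> c k /andP[c0 ck] E; have [_ ne] := etP k; apply: ne.
  have /dvdnP[d dE] : c %| k`! by rewrite dvdn_fact // c0.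
  have d0 : 0 < d by have := fact_gt0 k; rewrite dE muln_gt0 => /andP[].
  move: E; rewrite pwM ?fact_gt0 ?muln_gt0 ?c0 ?ob0 // => E.
  have -> : k`! * k`! * ob k = (k`! * (c * ob k)) * d by rewrite {2}dE; nia.
  by rewrite -pwM ?muln_gt0 ?fact_gt0 ?c0 ?ob0 // E pw_idem.
Qed.

End Groups.

(** * Products of lacunary sequences *)

Lemma seq_nat_max (w : seq nat) : w != [::] ->
  exists2 K, K \in w & all (leq^~ K) w.
Proof.
elim: w => [//|i [|j w] IH] _; first by exists i; rewrite ?mem_head //= leqnn.
have [K Kw Kub] := IH isT; have [iK|Ki] := leqP i K.
  by exists K; [rewrite inE Kw orbT|rewrite /= iK].
exists i; first exact: mem_head.
by rewrite /= leqnn; apply: sub_all Kub => k /= kK; apply: leq_trans kK (ltnW Ki).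
Qed.

Section LacunaryProducts.
Variables (S : Type) (op : S -> S -> S).
Hypotheses (opA : associative op) (opC : commutative op).
Local Notation "x ** y" := (op x y) (at level 40, left associativity).
Local Notation pw := (npow op).
Local Notation in_group := (in_group op).
Variables (e : S) (g : nat -> S) (ob : nat -> nat).
Hypotheses (ee : e ** e = e) (ge : forall k, in_group e (g k))
  (ob0 : forall k, 0 < ob k)
  (obK : forall i k, i < k -> pw (g i) (ob k) = e)
  (g_order : forall c k, 0 < c <= k -> pw (g k) (c * ob k) <> e).

Definition gprod (s : seq nat) : S := foldr (fun k a => g k ** a) e s.

Lemma in_group_gprod s : in_group e (gprod s).
Proof. by elim: s => [|k s IH]; [exact: in_group_id|exact: in_group_op]. Qed.

Lemma gprod_id s : e ** gprod s = gprod s.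
Proof. by rewrite opC; have [] := in_group_gprod s. Qed.

Lemma gprod_cat s t : gprod (s ++ t) = gprod s ** gprod t.
Proof. by elim: s => [|k s IH] /=; rewrite ?gprod_id // IH opA. Qed.

Lemma gprod_perm s t : perm_eq s t -> gprod s = gprod t.
Proof.
move=> st; apply: (catCA_perm_ind (P := fun t => gprod s = gprod t) _ st) => //.
by move=> s1 s2 s3 ->; rewrite !gprod_cat opCA.
Qed.

Lemma gprod_nseq c k : 0 < c -> gprod (nseq c k) = pw (g k) c.
Proof.
case: c => [//|c] _; elim: c => [|c IH]; first by have [] := ge k.
by rewrite pwSS -IH.
Qed.

Lemma gprod_ob s k : all (ltn^~ k) s -> pw (gprod s) (ob k) = e.
Proof.
elim: s => [|i s IH] /=; first by rewrite pw_idem.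
by move=> /andP[ik sk]; rewrite pwMl // IH // obK.
Qed.

(** The power [ob k] kills all factors of index below [k] and leaves [pw (g k) (c * ob k) = e],
    where the multiplicity [c] of [k] in [u] is at most [k], against [g_order]. *)
Lemma gprod_max_mem u v k : all (leq^~ k) u -> all (ltn^~ k) v ->
  size u <= k -> k \in u -> gprod u <> gprod v.
Proof.
move=> uk vk su ku E.
pose c := count_mem k u; have c0 : 0 < c by rewrite -has_count has_pred1.
pose a := [seq i <- u | predC (pred1 k) i].
have ak : all (ltn^~ k) a.
  apply/allP => i; rewrite mem_filter => /andP[ik iu].
  have := allP uk i iu; rewrite leq_eqVlt; case/orP => // /eqP ik'.
  by rewrite /= ik' eqxx in ik.
have pu : perm_eq (nseq c k ++ a) u.
  rewrite perm_sym -(perm_filterC (pred1 k)) perm_cat2r.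
  by have /all_pred1P -> : all (pred1 k) [seq i <- u | pred1 k i] := filter_all _ _;
    rewrite size_filter.
apply: (@g_order c k); first by rewrite c0 (leq_trans (count_size _ _) su).
have := congr1 (fun x => pw x (ob k)) E.
rewrite -(gprod_perm pu) gprod_cat pwMl // gprod_nseq // !gprod_ob // pwM //.
by have [-> _] := in_group_pw opA opC (c * ob k) ee (ge k).
Qed.

(* The largest index occurring in an equality of short products occurs on both
   sides by [gprod_max_mem], so it can be cancelled. *)
Lemma gprod_count M u v : size u + size v <= M -> gprod u = gprod v ->
  forall k, M <= k -> count_mem k u = count_mem k v.
Proof.
have [n] := ubnP (size u + size v); elim: n => [//|n IH] in u v *.
rewrite ltnS => uvn uvM E k Mk.
have [w0|w0] := posnP (size u + size v).
  have /nilP-> : size u == 0 by lia.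
  by have /nilP-> : size v == 0 by lia.
have [K Kw Kub] : exists2 K, K \in u ++ v & all (leq^~ K) (u ++ v).
  by apply: seq_nat_max; rewrite -size_eq0 size_cat -lt0n.
have [KM|MK] := ltnP K M.
  have kw : k \notin u ++ v.
    by apply/negP => kw; have /= := allP Kub k kw; lia.
  by move: kw; rewrite mem_cat negb_or => /andP[ku kv]; rewrite !(count_memPn _).
move: Kub; rewrite all_cat => /andP[Ku Kv].
have strict w : K \notin w -> all (leq^~ K) w -> all (ltn^~ K) w.
  move=> Kw' /allP wK; apply/allP => i iw; rewrite /= ltn_neqAle wK // andbT.
  by apply: contraNneq Kw' => <-.
have [Kinu|Ku'] := boolP (K \in u); have [Kinv|Kv'] := boolP (K \in v); last first.
- by move: Kw; rewrite mem_cat (negPf Ku') (negPf Kv').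
- case: (@gprod_max_mem v u K) => //; [exact: strict|lia].
- case: (@gprod_max_mem u v K) => //; [exact: strict|lia].
have pu := perm_to_rem Kinu; have pv := perm_to_rem Kinv.
rewrite (permP pu) (permP pv) /=; congr (_ + _).
have := perm_size pu; have := perm_size pv => /= sv su.
apply: IH => //; [lia|lia|].
apply: (in_group_cancel opA (ge K)); rewrite ?gprod_id //.
by move: E; rewrite (gprod_perm pu) (gprod_perm pv).
Qed.

(* One solution of [v g(s) = u g(t)] with the entries of [s] large determines
   which cofactor [u g(r)] equals [v], and then every [v g(s)] is a solution. *)
Lemma gprod_translate_dichotomy u v n l m : in_group e u -> in_group e v ->
  let hits s := exists t, [/\ size t = n, all (leq m) t & v ** gprod s = u ** gprod t] in
  exists m', (forall s, size s = l -> all (leq m') s -> hits s) \/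
             (forall s, size s = l -> all (leq m') s -> ~ hits s).
Proof.
move=> eu ev hits.
have [[s0 [s0l [t0 [t0n t0m E0]]]]|nhit] := pselect (exists s, size s = l /\ hits s);
  last by exists 0; right => s sl _ hs; apply: nhit; exists s.
have [K KP] : exists K, all (ltn^~ K) (s0 ++ t0).
  elim: (s0 ++ t0) => [|i w [K wK]]; first by exists 0.
  exists (maxn i.+1 K) => /=; rewrite leq_maxl /=.
  by apply: sub_all wK => j jK; rewrite /= (leq_trans jK) // leq_maxr.
(* No index from [K] on occurs in [s0] or [t0], and [2 * (n + l)] is the total length of the lists
   given to [gprod_count]. *)
pose m' := maxn m (K + 2 * (n + l)).
have [[s1 [s1l s1m' [t1 [t1n t1m E1]]]]|nhit] :=
  pselect (exists s, [/\ size s = l, all (leq m') s & hits s]); last first.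
  by exists m'; right => s sl sm' hs; apply: nhit; exists s.
exists m'; left => s sl sm'.
(* Cross-multiplying two solutions eliminates [u] and [v]; comparing large indices then embeds [s1]
   in [t1] with a remainder [r]. *)
have E2 : gprod (s0 ++ t1) = gprod (s1 ++ t0).
  rewrite !gprod_cat.
  apply: (in_group_cancel opA (in_group_op opA opC ee eu ev)).
  - by rewrite -gprod_cat gprod_id.
  - by rewrite -gprod_cat gprod_id.
  - transitivity ((v ** gprod s0) ** (u ** gprod t1)).
      by rewrite [RHS]opACA // [v ** u]opC.
    by rewrite E0 -E1 opACA // [gprod t0 ** _]opC.
have cnt k : K + 2 * (n + l) <= k -> count_mem k s1 <= count_mem k t1.
  move=> Kk; have k0 w : all (ltn^~ K) w -> count_mem k w = 0.
    move=> wK; apply/count_memPn/negP => kw.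
    by have /= := allP wK k kw; lia.
  have sz : size (s0 ++ t1) + size (s1 ++ t0) <= K + 2 * (n + l).
    by rewrite !size_cat s0l t0n s1l t1n; lia.
  have := gprod_count sz E2 Kk.
  move: KP; rewrite all_cat => /andP[s0K t0K].
  by rewrite !count_cat !(k0 s0) // !(k0 t0) // add0n addn0 => ->.
have [r pr] : exists r, perm_eq t1 (s1 ++ r).
  have /count_subseqP[s' ss' ps'] : forall k, count_mem k s1 <= count_mem k t1.
    move=> k; have [/cnt//|kK] := leqP (K + 2 * (n + l)) k.
    rewrite (count_memPn _) //; apply/negP => ks.
    by have /= := allP s1m' k ks; rewrite /m'; lia.
  have [r pr] := perm_to_subseq ss'; exists r.
  by rewrite (permPl pr) perm_cat2r perm_sym.
exists (r ++ s); split.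
- by have := perm_size pr; rewrite !size_cat t1n s1l sl addnC => ->.
- move: t1m; rewrite (perm_all _ pr) !all_cat => /andP[_ ->] /=.
  by apply: sub_all sm' => j; apply: leq_trans; exact: leq_maxl.
- have -> : v = u ** gprod r.
    have [[ue _] [ve _]] := (eu, ev).
    apply: (in_group_cancel opA (in_group_gprod s1)).
    + by rewrite opC.
    + by rewrite opA [e ** u]opC ue.
    + by rewrite opC E1 (gprod_perm pr) gprod_cat opCA.
  by rewrite gprod_cat opA.
Qed.

End LacunaryProducts.

(** * The ideal center *)

Section IdealCenter.
Variables (X : Type) (op : X -> X -> X).
Hypotheses (opA : associative op) (clX : C_closed TzS op).
Local Notation S := (IZtype op).
Local Notation "x ** y" := (IZop opA x y) (at level 40, left associativity).
Local Notation pw := (npow (IZop opA)).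

Lemma IZval_inj : injective (sval : S -> X).
Proof. by move=> [x px] [y py] /= xy; exact: eq_exist. Qed.

Lemma IZval_center (s : S) : center op (sval s).
Proof. by have [] := svalP s. Qed.

Lemma IZopA : associative (IZop opA).
Proof. by move=> x y z; apply: IZval_inj; exact: opA. Qed.

Lemma IZopC : commutative (IZop opA).
Proof. by move=> x y; apply: IZval_inj; exact: (IZval_center y). Qed.

Lemma IZval_pw (s : S) n : sval (pw s n) = npow op (sval s) n.
Proof.
case: n => [//|n]; elim: n => [//|n IH].
by rewrite !pwSS -IH.
Qed.

Lemma IZ_ideal x (s : S) : exists u : S, sval u = op x (sval s).
Proof.
have [sc sI] := svalP s.
have xs : op x (sval s) = op (sval s) x by exact: sc.
suff P : ideal_center op (op x (sval s)) by exists (exist _ _ P).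
by rewrite xs; split => [|y]; [exact: sI|rewrite -opA; exact: sI].
Qed.

Lemma IZval_infinite (A : set S) : infinite_set A -> infinite_set [set sval s | s in A].
Proof.
move=> Ainf Afin; apply: Ainf.
have := finite_preimage (f := sval) (fun i j _ _ => @IZval_inj i j) Afin.
by apply: sub_finite_set => s As; exists s.
Qed.

Lemma IZ_chain_finite : chain_finite (IZop opA).
Proof.
move=> A /IZval_infinite Ainf AA; apply: (center_chain_finite opA clX Ainf).
  by move=> _ [s _ <-]; exact: IZval_center.
by move=> _ _ [s As <-] [t At <-]; have [E|E] := AA s t As At;
  [left|right]; rewrite -[in RHS]E.
Qed.

Lemma IZ_nonsingular : nonsingular (IZop opA).
Proof.
move=> A c /IZval_infinite Ainf AA.
apply: (center_nonsingular opA clX (c := sval c) Ainf).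
  by move=> _ [s _ <-]; exact: IZval_center.
by move=> _ _ [s As <-] [t At <-]; rewrite -(AA s t).
Qed.

Lemma IZ_periodic : periodic (IZop opA).
Proof.
move=> s; have [n n0 E] := center_periodic opA (IZval_center s) clX.
by exists n => //; apply: IZval_inj; rewrite /= IZval_pw.
Qed.

Section Lacunary.
Variables (e : S) (g : nat -> S) (ob : nat -> nat).
Hypotheses (ee : e ** e = e) (ge : forall k, in_group (IZop opA) e (g k))
  (ob0 : forall k, 0 < ob k)
  (obK : forall i k, i < k -> pw (g i) (ob k) = e)
  (g_order : forall c k, 0 < c <= k -> pw (g k) (c * ob k) <> e).
Hypothesis absorb : forall u, u ** e = u -> in_group (IZop opA) e u \/
  exists m, forall k, m <= k -> u ** g k = u.
Local Notation gprod := (gprod (IZop opA) e g).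

(** Products of exactly [n] late factors, repetitions allowed; all lengths occur because lengths add
    under [fmul]. *)
Let L n : set_system X :=
  [set C | exists m, forall s, size s = n -> all (leq m) s -> C (sval (gprod s))].

Let L_proper n : ProperFilter (L n).
Proof.
apply: Build_ProperFilter_ex => [C [m mC]|].
  exists (sval (gprod (nseq n m))); apply: mC; first by rewrite size_nseq.
  by rewrite all_nseq leqnn orbT.
split; first by exists 0.
  move=> P Q [a aP] [b bQ]; exists (maxn a b) => s sn sab.
  split; [apply: aP|apply: bQ] => //; apply: sub_all sab => k; apply: leq_trans.
    exact: leq_maxl.
  exact: leq_maxr.
by move=> P Q PQ [m mP]; exists m => s sn sm; apply: PQ; exact: mP.
Qed.

Let L_mul n l : fmul op (L n) (L l) = L (n + l).
Proof.
apply/seteqP; split=> C.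
  move=> [P [Q [[a aP] [b bQ] PQ]]]; exists (maxn a b) => s snl.
  rewrite -(cat_take_drop n s) all_cat => /andP[s1 s2].
  rewrite (gprod_cat IZopA IZopC ee ge); apply: PQ.
    apply: aP; first by rewrite size_takel // snl leq_addr.
    by apply: sub_all s1 => k; apply: leq_trans; exact: leq_maxl.
  apply: bQ; first by rewrite size_drop snl addKn.
  by apply: sub_all s2 => k; apply: leq_trans; exact: leq_maxr.
move=> [m mC].
pose B n := [set x | exists s, [/\ size s = n, all (leq m) s & x = sval (gprod s)]].
exists (B n), (B l); split.
- by exists m => s sn sm; exists s.
- by exists m => s sn sm; exists s.
move=> _ _ [s [sn sm ->]] [t [tl tm ->]].
have -> : op (sval (gprod s)) (sval (gprod t)) = sval (gprod (s ++ t)).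
  by rewrite (gprod_cat IZopA IZopC ee ge).
by apply: mC; [rewrite size_cat sn tl|rewrite all_cat sm].
Qed.

(** As IZ(X) is an ideal, [u = x e] lies in it and acts on the products [gprod s] as [x] does. *)
Let shift_gprod o : exists2 u, u ** e = u &
  forall s, shift op o (sval (gprod s)) = sval (u ** gprod s).
Proof.
have eg s : e ** gprod s = gprod s by exact: (gprod_id IZopA IZopC ee ge).
case: o => [x|] /=; last by exists e => // s; rewrite -{1}eg.
have [u uE] := IZ_ideal x e; exists u.
  by apply: IZval_inj; rewrite /= uE -opA -[op (sval e) _]/(sval (e ** e)) ee.
by move=> s; rewrite -{1}eg /= opA uE.
Qed.

Let shift_cases o :
  (exists2 u, in_group (IZop opA) e u &
     forall s, shift op o (sval (gprod s)) = sval (u ** gprod s)) \/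
  (exists y m, forall s, all (leq m) s -> shift op o (sval (gprod s)) = y).
Proof.
have [u ue uE] := shift_gprod o.
have [eu|[m um]] := absorb ue; [by left; exists u|right].
exists (sval u), m => s sm; rewrite uE; congr sval.
elim: s sm => [//|k s IH] /= /andP[mk sm].
by rewrite IZopA um // IH.
Qed.

Let fshift_LP o n A : fshift op o (L n) A <->
  exists m, forall s, size s = n -> all (leq m) s -> A (shift op o (sval (gprod s))).
Proof. by apply: fshiftP; exact: L_proper. Qed.

Let decided_const o n A y m : (forall s, all (leq m) s ->
    shift op o (sval (gprod s)) = y) ->
  fshift op o (L n) A \/ fshift op o (L n) (~` A).
Proof.
move=> oy; have [Ay|Ay] := pselect (A y); [left|right]; apply/fshift_LP;
  by exists m => s sn sm; rewrite oy.
Qed.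

Let decided_translate o l u n m : in_group (IZop opA) e u ->
  let B := [set x | exists t, [/\ size t = n, all (leq m) t & x = sval (u ** gprod t)]] in
  fshift op o (L l) B \/ fshift op o (L l) (~` B).
Proof.
move=> eu B; have [[v ev vE]|[y [m' oy]]] := shift_cases o; last exact: decided_const oy.
have [m' [H|H]] := gprod_translate_dichotomy IZopA IZopC ee ge ob0 obK g_order
  n l m eu ev; [left|right]; apply/fshift_LP; exists m' => s sl sm'; rewrite vE.
  by have [t [tn tm E]] := H s sl sm'; exists t; split => //; rewrite E.
by move=> [t [tn tm /IZval_inj E]]; apply: (H s sl sm'); exists t.
Qed.

(** For [x] in the group of [e] this is [decided_translate] with [n = 0]; otherwise a translate that
    stays in the group avoids [x]. *)
Let decided_point o l x :
  fshift op o (L l) [set x] \/ fshift op o (L l) (~` [set x]).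
Proof.
have [[v ev vE]|[y [m' oy]]] := shift_cases o; last exact: decided_const oy.
have [[u [eu ux]]|nu] := pselect (exists u, in_group (IZop opA) e u /\ sval u = x).
  have := decided_translate o l 0 0 eu.
  set B := [set x | _]; suff -> : [set x] = B by [].
  have [ue _] := eu.
  apply/seteqP; split=> z.
    by move=> ->; exists [::]; split => //; rewrite /= -ux -[in LHS]ue.
  by move=> [t [/size0nil-> _ ->]]; rewrite /= -ux -[in RHS]ue.
right; apply/fshift_LP; exists 0 => s _ _; rewrite vE => E; apply: nu.
exists (v ** gprod s); split => //.
by apply: (in_group_op IZopA IZopC ee ev); exact: (in_group_gprod IZopA IZopC ee ge).
Qed.

(** If [L 1] contains a singleton, [g] is eventually constant; but [ob m.+1] kills [g m] and not
    [g m.+1]. *)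
Lemma lacunary_contradiction : False.
Proof.
have [x [m mx]] : exists x, L 1 [set x].
  apply: (@TzS_closed_central_filters _ op opA [set F | exists n, F = L n] clX) => //.
  - by move=> _ [n ->].
  - by move=> _ [n ->]; exists 0 => s _ _; exact: IZval_center.
  - by move=> _ _ [n ->] [l ->]; left; exists (n + l); exact: L_mul.
  - by move=> o _ x [l ->]; exact: decided_point.
  - move=> o _ A [n ->] oA.
    have [[u eu uE]|[y [m' oy]]] := shift_cases o.
      have /fshift_LP[m mA] := oA.
      pose B := [set x | exists t,
        [/\ size t = n, all (leq m) t & x = sval (u ** gprod t)]].
      exists B; split.
      + by apply/fshift_LP; exists m => s sn sm; exists s.
      + by move=> _ [t [tn tm ->]]; rewrite -uE; exact: mA.
      + by move=> o' _ [l ->]; exact: decided_translate.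
    exists [set y]; split.
    + by apply/fshift_LP; exists m' => s _ sm; exact: oy.
    + move=> _ ->; have /fshift_LP[m mA] := oA.
      have sm : all (leq (maxn m m')) (nseq n (maxn m m')).
        by rewrite all_nseq leqnn orbT.
      rewrite -(oy (nseq n (maxn m m'))).
        apply: mA; first by rewrite size_nseq.
        by apply: sub_all sm => k; apply: leq_trans; exact: leq_maxl.
      by apply: sub_all sm => k; apply: leq_trans; exact: leq_maxr.
    + by move=> o' _ [l ->]; exact: decided_point.
  by exists 1.
have gm k : m <= k -> sval (g k) = x.
  move=> mk; have [gke _] := ge k; rewrite -[in LHS]gke.
  by apply: (mx [:: k]) => //=; rewrite mk.
have gmS : g m = g m.+1 by apply: IZval_inj; rewrite !gm.
by apply: (@g_order 1 m.+1) => //; rewrite mul1n -gmS obK.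
Qed.

End Lacunary.

(** Take [e] minimal among the idempotents with unbounded group, and [u] in [e S]. Either [pi u = e]
    and [u] is in the group, or [pi u] has bounded group and [fixed_by_powers] gives an [n] such
    that [u] is fixed by [n]-th powers, hence by the [k!]-th powers [g k] with [k >= n]. *)
Lemma IZ_group_bounded : group_bounded (IZop opA).
Proof.
have [pi [pi_pw pi_idem]] := periodic_idempotent_power IZ_periodic.
move=> e0 e0e0; apply: contrapT => unb0.
have [e [ee unb] emin] := @min_idem _ (IZop opA) IZopA IZopC
  [set e | e ** e = e /\ ~ bounded_at (IZop opA) e] e0 IZ_chain_finite
  (fun x => @proj1 _ _) (conj e0e0 unb0).
have [g [ob [ge gfact ob0 obK g_order]]] :=
  lacunary_sequence IZopA IZopC ee unb.
apply: (lacunary_contradiction ee ge ob0 obK g_order) => u ue.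
have [bu|nbu] := pselect (bounded_at (IZop opA) (pi u)); last first.
  left; have [q q0 uq] := pi_pw u.
  suff pe : pi u = e by split => //; exists q => //; rewrite uq.
  by apply: emin => //; rewrite -uq (pw_op_id IZopA).
right; have [n n0 fixn] := fixed_by_powers IZopA IZopC IZ_nonsingular pi_pw pi_idem
  ee ue bu.
exists n => k nk; have [h eh ->] := gfact k.
have /dvdnP[d dE] : n %| k`! by rewrite dvdn_fact // n0.
have d0 : 0 < d by have := fact_gt0 k; rewrite dE muln_gt0 => /andP[].
rewrite dE -(pwM IZopA) // fixn //.
exact: (in_group_pw IZopA IZopC).
Qed.

End IdealCenter.

Theorem theorem1p8 (X : Type) (op : X -> X -> X) (Hassoc : associative op) :
  C_closed TzS op -> C_closed T1S (IZop Hassoc).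
Proof.
move=> clX; apply: T1S_closed_of_commutative.
- exact: IZopA.
- exact: IZopC.
- exact: IZ_chain_finite.
- exact: IZ_nonsingular.
- exact: IZ_periodic.
- exact: IZ_group_bounded.
Qed.
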